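(* Let $\mathcal{X}=(X,\mathcal{B},\mu)$ be a separable probability space, let $\tau$ be an ergodic measure preserving transformation of $\mathcal{X}$, and let $T$ be the associated Koopman operator. Then for any $f\in L^2(\mathcal{X})$, bounds on the rate of convergence of $(A_nf)$ in the $L^2$ norm, in the $L^1$ norm, and in the pointwise sense (defined in the context) can be computed from $f$, $T$, and $\mu$. Moreover, for any $f\in L^1(\mathcal{X})$, bounds on the rate of convergence of $(A_nf)$ in the $L^1$ norm and in the pointwise sense can be computed from $T$, $\mu$, and a sequence of $L^2(\mathcal{X})$ functions approximating $f$ in the $L^1$ norm (together with a rate of convergence).
   Context: $Tf=f\circ\tau$, and $A_nf=\frac1n\sum_{0\le i<n}T^if$ for $n\ge1$. $\tau$ is ergodic if $\tau^{-1}(A)=A$ implies $\mu(A)\in\{0,1\}$. A bound on the rate of convergence in a norm is a function $r$ from positive rationals to positive integers such that $\|A_mf-A_{r(\varepsilon)}f\|<\varepsilon$ for all rational $\varepsilon>0$ and all $m\ge r(\varepsilon)$. A bound on the rate of convergence in the pointwise sense is a function assigning to all rational $\lambda_1,\lambda_2>0$ an $n\ge1$ such that for every $k\ge n$, $\mu(\{x \mid \max_{n\le m\le k}|A_mf(x)-A_nf(x)|>\lambda_1\})\le\lambda_2$. Computability conventions (standard computable analysis). A representation of a real number is a sequence of rationals converging to it together with a bound on the rate of convergence. The separable Hilbert space $L^2(\mathcal{X})$ comes with a fixed countable basis of suitably simple functions, with respect to which the inner product and norm are computable; the measure $\mu$ is given through the integrals of these functions. An element of $L^2(\mathcal{X})$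 is represented by a sequence of finite rational linear combinations of basis elements converging to it in norm together with a bound on the rate of convergence (up to a.e. equality), and a bounded linear operator by (representations of) its values on the basis. An object ''can be computed from'' given data if there is an algorithm which, given oracle access to any representations of the data, computes a representation of the object. *)

(* Defs.v *)
From mathcomp Require Import all_boot all_order all_algebra.
From mathcomp Require Import all_classical all_reals all_analysis.

Set Implicit Arguments.
Unset Strict Implicit.
Unset Printing Implicit Defensive.
Import Order.TTheory GRing.Theory Num.Theory.
Import numFieldNormedType.Exports.
Local Open Scope classical_set_scope.
Local Open Scope ring_scope.

(* Baire space, with functions taking finite tuples of numbers (as sequences)
   as arguments, so that oracles need no coding of pairs. *)
Definition baire := seq nat -> nat.

(* Kleene's mu-recursive functions, with one oracle in [baire]. *)
Inductive prog : Type :=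
| Zero
| Succ
| Proj of nat
| Orc
| Comp of prog & seq prog
| Rec of prog & prog
| Mu of prog.

(* [eval o P xs y]: with oracle [o], the program [P] halts on input [xs] with
   output [y].  Missing arguments are read as 0. *)
Fixpoint eval (o : baire) (P : prog) {struct P} : seq nat -> nat -> Prop :=
  match P with
  | Zero => fun _ y => y = 0%N
  | Succ => fun xs y => y = (head 0%N xs).+1
  | Proj i => fun xs y => y = nth 0%N xs i
  | Orc => fun xs y => y = o xs
  | Comp F Gs => fun xs y =>
      exists2 ys : seq nat,
        (fix evals (Gs : seq prog) (ys : seq nat) {struct Gs} : Prop :=
           match Gs, ys with
           | [::], [::] => True
           | G :: Gs', z :: ys' => eval o G xs z /\ evals Gs' ys'
           | _, _ => False
           end) Gs ys
        & eval o F ys y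
  | Rec F G => fun xs y =>
      (fix rec (n : nat) (y : nat) {struct n} : Prop :=
         match n with
         | 0%N => eval o F (behead xs) y
         | n'.+1 => exists2 z, rec n' z & eval o G [:: n', z & behead xs] y
         end) (head 0%N xs) y
  | Mu F => fun xs n =>
      eval o F (n :: xs) 0%N /\
      forall m, (m < n)%N -> exists k, eval o F (m :: xs) k.+1
  end.

(* With oracle [o], [P] computes some representation, in the sense of
   [represents], of the intended object. *)
Definition computes (P : prog) (o : baire) (represents : baire -> Prop) : Prop :=
  exists2 w : baire, represents w & forall xs, eval o P xs (w xs).

(* A function [w] carries several functions at once: the [k]-th one. *)
Definition part (k : nat) (w : baire) : baire := fun xs => w (k :: xs).

Definition rep_seq (A : Type) (rep : A -> baire -> Prop) (a : nat -> A)
    (w : baire) : Prop :=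
  forall j, rep (a j) (part j w).

(* The rational (a - b) / (c + 1), from its three components. *)
Definition qval (w : baire) (xs : seq nat) : rat :=
  ((part 0 w xs)%:R - (part 1 w xs)%:R) / (part 2 w xs).+1%:R.

Definition posq (p q : nat) : rat := p.+1%:R / q.+1%:R.

Section Rates.
Context {R : realType}.

(* [dist m n] is the distance between the [m]-th and [n]-th terms of a sequence.
   Only the values of [r] at positive rationals are relevant. *)
Definition rate_bound (dist : nat -> nat -> \bar R) (r : rat -> nat) : Prop :=
  forall e : rat, 0 < e ->
    (0 < r e)%N /\ forall m, (r e <= m)%N -> (dist m (r e) < (ratr e)%:E)%E.

Definition rep_rate (dist : nat -> nat -> \bar R) (w : baire) : Prop :=
  exists2 r : rat -> nat,
    rate_bound dist r & forall p q, w [:: p; q] = r (posq p q).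

Definition rep_real (x : R) (w : baire) : Prop :=
  let u n : R := ratr (qval (part 0 w) [:: n]) in
  u n @[n --> \oo] --> x /\
  rep_rate (fun m n => `|u m - u n|%:E) (part 1 w).

End Rates.

Section Dynamics.
Context {d : measure_display} {X : measurableType d} {R : realType}.
Variables (mu : probability X R) (tau : X -> X).

Definition measure_preserving : Prop :=
  measurable_fun setT tau /\
  forall A, measurable A -> mu (tau @^-1` A) = mu A.

Definition ergodic : Prop :=
  forall A, measurable A -> tau @^-1` A = A -> mu A = 0%E \/ mu A = 1%E.

Definition koopman (f : X -> R) : X -> R := f \o tau.

Definition avg (f : X -> R) (n : nat) : X -> R :=
  fun x => n%:R^-1 * \sum_(0 <= i < n) iter i koopman f x.

Definition Ldist (p : \bar R) (u : nat -> X -> R) (m n : nat) : \bar R :=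
  ('N[mu]_p [EFin \o (u m \- u n)%R])%E.

Definition Lconv (p : \bar R) (u : nat -> X -> R) (f : X -> R) : Prop :=
  ('N[mu]_p [EFin \o (u n \- f)%R])%E @[n --> \oo] --> 0%E.

(* The maximum is taken over nonnegative numbers, so its default value 0 is
   harmless. *)
Definition pointwise_bound (u : nat -> X -> R) (N : rat -> rat -> nat) : Prop :=
  forall l1 l2 : rat, 0 < l1 -> 0 < l2 ->
    let n := N l1 l2 in
    (0 < n)%N /\
    forall k, (n <= k)%N ->
      (mu [set x | (ratr l1 < \big[Num.max/0]_(n <= m < k.+1) `|u m x - u n x|)%R]
         <= (ratr l2)%:E)%E.

Definition rep_pointwise (u : nat -> X -> R) (w : baire) : Prop :=
  exists2 N : rat -> rat -> nat, pointwise_bound u N &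
    forall p1 q1 p2 q2, w [:: p1; q1; p2; q2] = N (posq p1 q1) (posq p2 q2).

Variable b : nat -> X -> R.

Definition lincomb (n : nat) (c : nat -> rat) : X -> R :=
  fun x => \sum_(0 <= i < n) ratr (c i) * b i x.

(* Basis in the sense of a sequence whose finite rational combinations are
   dense; its existence is the separability of the space. *)
Definition L2_basis : Prop :=
  (forall i, b i \in Lfun mu 2%:E) /\
  forall f, f \in Lfun mu 2%:E -> forall e : R, 0 < e ->
    exists n c, ('N[mu]_2%:E [EFin \o (lincomb n c \- f)%R] < e%:E)%E.

(* The [n]-th approximation has [part 0 w [:: n]] terms, with coefficients
   given by [part 1 w]. *)
Definition rep_L2 (f : X -> R) (w : baire) : Prop :=
  let u n := lincomb (part 0 w [:: n]) (fun i => qval (part 1 w) [:: n; i]) in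
  Lconv 2%:E u f /\ rep_rate (Ldist 2%:E u) (part 2 w).

Definition rep_measure : baire -> Prop :=
  rep_seq rep_real (fun i => (\int[mu]_x b i x)%R).

Definition rep_gram : baire -> Prop :=
  rep_seq (rep_seq rep_real) (fun i j => (\int[mu]_x (b i x * b j x))%R).

Definition rep_koopman : baire -> Prop :=
  rep_seq rep_L2 (fun j => koopman (b j)).

(* The inner product of basis elements is computed by [G] from the measure; a
   [G] that never queries its oracle is the case of a computable inner product,
   and the norm of a rational combination is determined by these values. *)
Definition inner_product_computed_by (G : prog) : Prop :=
  forall w, rep_measure w -> computes G w rep_gram.

Definition rep_L1_approx (f : X -> R) (w : baire) : Prop :=
  exists g : nat -> X -> R,
    [/\ forall k, g k \in Lfun mu 2%:E,
        Lconv 1%:E g f,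
        rep_seq rep_L2 g (part 0 w) &
        rep_rate (Ldist 1%:E g) (part 1 w)].

Definition rep_data (rep : baire -> Prop) (w : baire) : Prop :=
  [/\ rep_measure (part 0 w), rep_koopman (part 1 w) & rep (part 2 w)].

End Dynamics.

(* Main.v *)
Require Import Defs.
From mathcomp Require Import all_boot all_order all_algebra.
From mathcomp Require Import all_classical all_reals all_analysis.
From mathcomp Require Import ring lra zify measurable_realfun.
Import Order.TTheory GRing.Theory Num.Theory.
Import numFieldNormedType.Exports.
Local Open Scope classical_set_scope.
Local Open Scope ring_scope.
Set Implicit Arguments.
Unset Strict Implicit.
Unset Printing Implicit Defensive.

(* By ergodicity, [f] is within [e] (in L2) of [c + (h - T h)] for a constant
   [c] and a finite rational combination [h] of the basis: by the mean ergodic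
   theorem [A_n f] is close to a constant, and [f - A_n f] is a coboundary.
   Such a pair [(c, h)] can be searched for, since the approximate identity and
   a bound [t] on the norm of [h] are rational inequalities in approximations
   of inner products and of the vectors [T b_j].  Once it is found, with
   [r = f - c - (h - T h)],
     [A_m f - c = (h - T^m h) / m + A_m r],
   so [A_m f] is within [2 t / m + |r|] of [c] in norm.  Pointwise, the maximal
   ergodic theorem bounds the measure of [sup_m |A_m r| > l] by [|r|_1 / l], and
   Chebyshev's inequality bounds that of [|T^m h| > l m] by [t^2 / (l m)^2],
   which is summable in [m].  The limit itself need not be computed.  For [f] in
   L1, a close enough L2 function is used and the difference goes into [r]. *)

(* Topology has another [eval]. *)
Local Notation eval := Defs.eval.

(** * Oracle programs *)

(** The programs are fixed before the space, the map and [f], so whatever they handle has to be a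
    number obtained from queries. Pairs [(c, h)] are therefore coded by numbers and tested by
    comparing rationals. True norms are reals and cannot be compared decidably; the test adds the
    full error of the approximations to the approximate value. An accepted code is then always
    correct, and a code that meets the bound with room to spare is accepted once the precision is
    high. Ergodicity supplies such a code, and thus the termination of the search.

    One number [t] bounds the codes tried, sets the precision of the integrals and bounds the norm
    of [h], so that one unbounded search returns the only quantity that the rates use.

    The mean ergodic theorem is derived from the maximal ergodic theorem, which the pointwise rate
    needs in any case: averages of bounded functions converge almost everywhere, hence in L2 by
    dominated convergence, and truncation extends this to all of L2. *)

Definition evals (o : baire) (xs : seq nat) :=
  fix evals (Gs : seq prog) (ys : seq nat) {struct Gs} : Prop :=
    match Gs, ys with
    | [::], [::] => True
    | G :: Gs', z :: ys' => eval o G xs z /\ evals Gs' ys'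
    | _, _ => False
    end.

Lemma evals_size o xs Gs ys : evals o xs Gs ys -> size ys = size Gs.
Proof. by elim: Gs ys => [|G Gs IH] [|y ys] //= [_ /IH ->]. Qed.

Lemma evals_proj o xs n : size xs = n ->
  evals o xs [seq Proj i | i <- iota 0 n] xs.
Proof.
move=> <-; suff gen m : evals o xs [seq Proj i | i <- iota m (size xs - m)] (drop m xs).
  by have := gen 0%N; rewrite subn0 drop0.
move: {-1}(_ - m)%N (erefl (size xs - m)%N) => k.
elim: k m => [|k IH] m km.
  by rewrite drop_oversize// -subn_eq0 km.
have mxs : (m < size xs)%N by rewrite -subn_gt0 km.
rewrite (drop_nth 0%N)//=; split=> //.
by apply: IH; rewrite subnS km.
Qed.

Section ProgInd.
Variable Q : prog -> Prop.
Hypotheses (QZ : Q Zero) (QS : Q Succ) (QP : forall i, Q (Proj i)) (QO : Q Orc).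
Hypothesis QC : forall F Gs, Q F -> foldr (fun G => and (Q G)) True Gs -> Q (Comp F Gs).
Hypothesis QR : forall F G, Q F -> Q G -> Q (Rec F G).
Hypothesis QM : forall F, Q F -> Q (Mu F).
Fixpoint prog_nested_ind (P : prog) : Q P :=
  match P with
  | Zero => QZ
  | Succ => QS
  | Proj i => QP i
  | Orc => QO
  | Comp F Gs => QC (prog_nested_ind F)
      ((fix all_ind (Gs : seq prog) : foldr (fun G => and (Q G)) True Gs :=
         match Gs with
         | [::] => I
         | G :: Gs' => conj (prog_nested_ind G) (all_ind Gs')
         end) Gs)
  | Rec F G => QR (prog_nested_ind F) (prog_nested_ind G)
  | Mu F => QM (prog_nested_ind F)
  end.
End ProgInd.

(* The length of the argument list at each oracle call is determined by the
   length [n] of the input, so that a query [xs] can be replaced by [0 :: xs],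
   although no single program maps every [xs] to [0 :: xs]. *)
Fixpoint query_part0 (n : nat) (P : prog) : prog :=
  match P with
  | Orc => Comp Orc (Zero :: [seq Proj i | i <- iota 0 n])
  | Comp F Gs => Comp (query_part0 (size Gs) F) (map (query_part0 n) Gs)
  | Rec F G => Rec (query_part0 n.-1 F) (query_part0 n.-1.+2 G)
  | Mu F => Mu (query_part0 n.+1 F)
  | _ => P
  end.

Lemma eval_query_part0 o P n xs y : size xs = n ->
  eval (part 0 o) P xs y -> eval o (query_part0 n P) xs y.
Proof.
elim/prog_nested_ind: P n xs y => //.
- move=> n xs y sxs /= ->; exists (0%N :: xs) => //.
  by split=> //; exact: evals_proj.
- move=> F Gs IHF IHGs n xs y sxs /=.
  case=> ys eys /IHF/= => /(_ _ (evals_size eys)) eF.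
  exists ys => //.
  elim: Gs ys eys IHGs {eF} => [|G Gs IH] [|z ys] //= [ez ezs] [hG hGs].
  by split; [exact: hG | exact: IH].
- move=> F G IHF IHG n xs y sxs /=.
  elim: (head 0%N xs) y => [|m IH] y.
    by apply: IHF; rewrite size_behead sxs.
  case=> z /IH ez eG; exists z => //.
  by apply: IHG eG; rewrite /= size_behead sxs.
- move=> F IHF n xs y sxs /= [e0 em]; split; first by apply: IHF e0; rewrite /= sxs.
  move=> m /em [k ek]; exists k; apply: IHF ek; by rewrite /= sxs.
Qed.

Section Computable.
Variables (env : Type) (orc : env -> baire).

(* Contexts: [ctx_arg] lists the numbers that a program run in the context has
   as its input, [ctx_env] is the rest of the data, accessible by oracle only. *)
Record ctx := Ctx {
  ctx_sort :> Type;
  ctx_env : ctx_sort -> env;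
  ctx_arg : ctx_sort -> seq nat;
  ctx_arity : nat;
  size_ctx_arg : forall c, size (ctx_arg c) = ctx_arity }.

Program Definition ctx_ext (C : ctx) : ctx :=
  @Ctx (C * nat) (fun c => ctx_env c.1) (fun c => c.2 :: ctx_arg c.1)
    (ctx_arity C).+1 _.
Next Obligation. by move=> C c /=; rewrite size_ctx_arg. Qed.

(** One program serves all points of the context, hence all environments: uniformity in the oracle
    is part of this notion. *)
Definition computable (C : ctx) (t : C -> nat) : Prop :=
  exists P, forall c, eval (orc (ctx_env c)) P (ctx_arg c) (t c).

Definition computables (C : ctx) (ts : seq (C -> nat)) : Prop :=
  foldr (fun t => and (computable t)) True ts.

Lemma computables_evals (C : ctx) (ts : seq (C -> nat)) : computables ts ->
  exists Ps, forall c,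
    evals (orc (ctx_env c)) (ctx_arg c) Ps [seq t c | t <- ts].
Proof.
elim: ts => [_|t ts IH [[P hP] /IH[Ps hPs]]]; first by exists [::].
by exists (P :: Ps) => c; split.
Qed.

Lemma computable_ext (C : ctx) (t u : C -> nat) :
  t =1 u -> computable t -> computable u.
Proof. by move=> tu [P hP]; exists P => c; rewrite -tu. Qed.

Lemma computable_comp (C : ctx) (P : prog) (f : env -> baire) (ts : seq (C -> nat)) :
  (forall e xs, size xs = size ts -> eval (orc e) P xs (f e xs)) ->
  computables ts -> computable (fun c => f (ctx_env c) [seq t c | t <- ts]).
Proof.
move=> hP /computables_evals[Ps hPs]; exists (Comp P Ps) => c.
exists [seq t c | t <- ts]; first exact: hPs.
by apply: hP; rewrite size_map.
Qed.

Lemma computable_orc (C : ctx) (ts : seq (C -> nat)) :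
  computables ts -> computable (fun c => orc (ctx_env c) [seq t c | t <- ts]).
Proof. exact: (@computable_comp C Orc orc). Qed.

Lemma computable_cst (C : ctx) (n : nat) : computable (fun _ : C => n).
Proof.
elim: n => [|n [P hP]]; first by exists Zero.
by exists (Comp Succ [:: P]) => c; exists [:: n].
Qed.

Lemma computable_succ (C : ctx) (t : C -> nat) :
  computable t -> computable (fun c => (t c).+1).
Proof.
by move=> [P hP]; exists (Comp Succ [:: P]) => c; exists [:: t c].
Qed.

Lemma computable_var (C : ctx) : computable (fun c : ctx_ext C => c.2).
Proof. by exists (Proj 0). Qed.

Lemma computable_weak (C : ctx) (t : C -> nat) :
  computable t -> computable (fun c : ctx_ext C => t c.1).
Proof.
move=> [P hP]; exists (Comp P [seq Proj i | i <- iota 1 (ctx_arity C)]) => -[c n] /=.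
exists (ctx_arg c) => //=.
have /= := @evals_proj (orc (ctx_env c)) (n :: ctx_arg c) (ctx_arity C).+1.
by rewrite size_ctx_arg => /(_ erefl)[].
Qed.

Lemma computable_rec (C : ctx) (N F : C -> nat) (G : C -> nat -> nat -> nat) :
  computable N -> computable F ->
  computable (fun c : ctx_ext (ctx_ext C) => G c.1.1 c.2 c.1.2) ->
  computable (fun c => nat_rect (fun _ => nat) (F c) (G c) (N c)).
Proof.
move=> [PN hN] [PF hF] [PG hG].
exists (Comp (Rec PF PG) (PN :: [seq Proj i | i <- iota 0 (ctx_arity C)])) => c.
exists (N c :: ctx_arg c) => /=.
  by split; [exact: hN | exact/evals_proj/size_ctx_arg].
elim: (N c) => [|n IH] /=; first exact: hF.
by exists (nat_rect (fun _ => nat) (F c) (G c) n) => //; exact: (hG (c, _, n)).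
Qed.

(** [Mu] stops at a zero and demands a positive value at every smaller number, so it is run on the
    negated test and returns the least solution. *)
Lemma computable_search (C : ctx) (p : C -> nat -> bool) :
  computable (fun c : ctx_ext C => p c.1 c.2 : nat) ->
  (forall c, exists n, p c n) ->
  exists2 N : C -> nat, computable N & forall c, p c (N c).
Proof.
move=> [P hP] ex.
exists (fun c => ex_minn (ex c)); last by move=> c; case: ex_minnP.
have [one h1] := computable_cst (ctx_ext C) 1.
have hnot : computable (fun c : ctx_ext C => ~~ p c.1 c.2 : nat).
  apply: (@computable_ext (ctx_ext C)
    (fun c => nat_rect (fun _ => nat) 1%N (fun _ _ => 0%N) (p c.1 c.2 : nat))).
    by move=> c; case: (p _ _).
  apply: computable_rec; [by exists P | exact: computable_cst | exact: computable_cst].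
case: hnot => Q hQ; exists (Mu Q) => c /=.
case: ex_minnP => n pn minn; split.
  by have := hQ (c, n); rewrite /= pn.
move=> m mn; exists 0%N; have := hQ (c, m) => /=.
by case: (boolP (p c m)) => // /minn; rewrite leqNgt mn.
Qed.

End Computable.

(** Two numbers [B] and [s] code a finite sequence by digits in base [B + 1]. Every pair is a code
    of some sequence of any chosen length, so a search over codes is a search over numbers with no
    pair to reject. *)
Definition digit (B s i : nat) : nat := (s %/ B.+1 ^ i %% B.+1)%N.

Definition rat_digit (B s i : nat) : rat :=
  ((digit B s (3 * i))%:R - (digit B s (3 * i).+1)%:R) /
  (digit B s (3 * i).+2).+1%:R.

(** * Computable arithmetic of natural and rational numbers *)

Section Arithmetic.
Variables (env : Type) (orc : env -> baire).
Implicit Types C : ctx env.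
Local Notation computable := (computable orc).

(** In the step of [computable_rec] the accumulated value stands between the counter and the
    context. Dropping it gives the terms of sums and products, which do not depend on it. *)
Lemma computable_weak1 C (t : ctx_ext C -> nat) : computable t ->
  computable (fun c : ctx_ext (ctx_ext C) => t (c.1.1, c.2)).
Proof.
move=> [P hP].
exists (Comp P (Proj 0 :: [seq Proj i | i <- iota 2 (ctx_arity C)])) => -[[c m] n] /=.
exists (n :: ctx_arg c); last exact: (hP (c, n)).
split=> //.
have /= := @evals_proj (orc (ctx_env c)) (n :: m :: ctx_arg c) (ctx_arity C).+2.
by rewrite size_ctx_arg => /(_ erefl)[_ []].
Qed.

Lemma computable_add C (t u : C -> nat) :
  computable t -> computable u -> computable (fun c => (t c + u c)%N).
Proof.
move=> ht hu.
apply: (@computable_ext _ _ _ (fun c => nat_rect (fun _ => nat) (t c) (fun _ z => z.+1) (u c))).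
  by move=> c; elim: (u c) => [|n /= ->]; rewrite ?addn0 ?addnS.
apply: computable_rec => //.
by apply: computable_succ; exact/computable_weak/computable_var.
Qed.

Lemma computable_sum C (N : C -> nat) (F : C -> nat -> nat) :
  computable N -> computable (fun c : ctx_ext C => F c.1 c.2) ->
  computable (fun c => (\sum_(0 <= j < N c) F c j)%N).
Proof.
move=> hN hF.
apply: (@computable_ext _ _ _
  (fun c => nat_rect (fun _ => nat) 0%N (fun j z => (z + F c j)%N) (N c))).
  by move=> c; elim: (N c) => [|n /= ->]; rewrite ?big_nil ?big_nat_recr.
apply: computable_rec => //; first exact: computable_cst.
apply: computable_add; first exact/computable_weak/computable_var.
exact: (computable_weak1 hF).
Qed.

Lemma computable_mul C (t u : C -> nat) :
  computable t -> computable u -> computable (fun c => (t c * u c)%N).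
Proof.
move=> ht hu.
apply: (@computable_ext _ _ _ (fun c => \sum_(0 <= j < u c) t c)%N).
  by move=> c; rewrite sum_nat_const_nat subn0 mulnC.
apply: computable_sum => //; exact: computable_weak.
Qed.

Lemma computable_prod C (N : C -> nat) (F : C -> nat -> nat) :
  computable N -> computable (fun c : ctx_ext C => F c.1 c.2) ->
  computable (fun c => (\prod_(0 <= j < N c) F c j)%N).
Proof.
move=> hN hF.
apply: (@computable_ext _ _ _
  (fun c => nat_rect (fun _ => nat) 1%N (fun j z => (z * F c j)%N) (N c))).
  by move=> c; elim: (N c) => [|n /= ->]; rewrite ?big_nil ?big_nat_recr.
apply: computable_rec => //; first exact: computable_cst.
apply: computable_mul; first exact/computable_weak/computable_var.
exact: (computable_weak1 hF).
Qed.

Lemma computable_expn C (t u : C -> nat) :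
  computable t -> computable u -> computable (fun c => (t c ^ u c)%N).
Proof.
move=> ht hu.
apply: (@computable_ext _ _ _ (fun c => \prod_(0 <= j < u c) t c)%N).
  by move=> c; rewrite prod_nat_const_nat subn0.
apply: computable_prod => //; exact: computable_weak.
Qed.

Lemma computable_pred C (t : C -> nat) :
  computable t -> computable (fun c => (t c).-1).
Proof.
move=> ht.
apply: (@computable_ext _ _ _
  (fun c => nat_rect (fun _ => nat) 0%N (fun n _ => n) (t c))).
  by move=> c; case: (t c).
apply: computable_rec => //; first exact: computable_cst.
exact: computable_var.
Qed.

Lemma computable_sub C (t u : C -> nat) :
  computable t -> computable u -> computable (fun c => (t c - u c)%N).
Proof.
move=> ht hu.
apply: (@computable_ext _ _ _
  (fun c => nat_rect (fun _ => nat) (t c) (fun _ z => z.-1) (u c))).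
  by move=> c; elim: (u c) => [|n /= ->]; rewrite ?subn0 ?subnS.
apply: computable_rec => //.
by apply: computable_pred; exact/computable_weak/computable_var.
Qed.

Lemma computable_leq C (t u : C -> nat) :
  computable t -> computable u -> computable (fun c => (t c <= u c)%N : nat).
Proof.
move=> ht hu.
apply: (@computable_ext _ _ _ (fun c => 1 - (t c - u c))%N).
  by move=> c; rewrite /leq; case: (t c - u c)%N => [|n]; rewrite ?subSS ?sub0n.
apply: computable_sub; [exact: computable_cst | exact: computable_sub].
Qed.

Lemma computable_and C (p q : C -> bool) :
  computable (fun c => p c : nat) -> computable (fun c => q c : nat) ->
  computable (fun c => p c && q c : nat).
Proof.
move=> hp hq; apply: computable_ext (computable_mul hp hq) => c.
by rewrite mulnb.
Qed.

Lemma computable_exists C (N : C -> nat) (p : C -> nat -> bool) :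
  computable N -> computable (fun c : ctx_ext C => p c.1 c.2 : nat) ->
  computable (fun c => has (p c) (iota 0 (N c)) : nat).
Proof.
move=> hN hp.
have := computable_leq (computable_cst _ C 1) (@computable_sum C N (fun c j => p c j) hN hp).
apply: computable_ext => c; rewrite has_count -sum1_count /index_iota subn0.
by rewrite [in RHS]big_mkcond; congr nat_of_bool.
Qed.

(** The quotient is the number of positive multiples of the divisor that are at most the dividend,
    so it is a bounded sum of truth values. *)
Lemma computable_divS C (t u : C -> nat) :
  computable t -> computable u -> computable (fun c => (t c %/ (u c).+1)%N).
Proof.
move=> ht hu.
apply: (@computable_ext _ _ _
   (fun c => \sum_(0 <= k < t c) (k.+1 * (u c).+1 <= t c : nat))%N).
  move=> c; rewrite (eq_bigr (fun k => (k < t c %/ (u c).+1)%N : nat)); last first.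
    by move=> k _; rewrite -leq_divRL.
  rewrite (@big_cat_nat _ _ _ (t c %/ (u c).+1)%N) ?leq_div//=.
  rewrite [X in (X + _)%N](eq_big_nat _ _ (F2 := fun _ => 1%N)); last first.
    by move=> i /andP[_ ->].
  rewrite [X in (_ + X)%N](eq_big_nat _ _ (F2 := fun _ => 0%N)); last first.
    by move=> i /andP[h _]; rewrite ltnNge h.
  by rewrite !sum_nat_const_nat subn0 muln1 muln0 addn0.
apply: computable_sum => //; apply: (computable_leq (C := ctx_ext C)).
  apply: computable_mul; first exact/computable_succ/computable_var.
  exact/computable_succ/(computable_weak (t := u)).
exact: (computable_weak (t := t)).
Qed.

Lemma computable_digit C (B s i : C -> nat) :
  computable B -> computable s -> computable i ->
  computable (fun c => digit (B c) (s c) (i c)).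
Proof.
move=> hB hs hi.
have hq : computable (fun c => (s c %/ (B c).+1 ^ i c)%N).
  apply: (@computable_ext _ _ _ (fun c => s c %/ (((B c).+1 ^ i c).-1).+1)%N).
    by move=> c; rewrite prednK ?expn_gt0.
  by apply: computable_divS => //; apply: computable_pred; apply: computable_expn => //;
    exact: computable_succ.
pose q c := (s c %/ (B c).+1 ^ i c)%N.
apply: (@computable_ext _ _ _ (fun c => q c - (q c %/ (B c).+1) * (B c).+1)%N).
  by move=> c; rewrite /digit [in RHS]modn_def; case: edivnP => a r /= E;
    rewrite /q E; move=> h; rewrite divnMDl// divn_small// addn0 addKn.
apply: computable_sub => //; apply: computable_mul; last exact: computable_succ.
exact: computable_divS.
Qed.

Definition computableQ C (t : C -> rat) : Prop :=
  exists a b d : C -> nat, [/\ computable a, computable b, computable d &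
    forall c, t c = ((a c)%:R - (b c)%:R) / (d c).+1%:R].

Lemma computableQ_ext C (t u : C -> rat) :
  t =1 u -> computableQ t -> computableQ u.
Proof.
by move=> tu [a [b [d [ha hb hd E]]]]; exists a, b, d; split=> // c; rewrite -tu.
Qed.

Lemma computableQ_weak C (t : C -> rat) :
  computableQ t -> computableQ (fun c : ctx_ext C => t c.1).
Proof.
move=> [a [b [d [ha hb hd E]]]].
by exists (a \o fst), (b \o fst), (d \o fst); split=> //; exact: computable_weak.
Qed.

Lemma computableQ_qval C (a b d : C -> nat) :
  computable a -> computable b -> computable d ->
  computableQ (fun c => ((a c)%:R - (b c)%:R) / (d c).+1%:R).
Proof. by exists a, b, d. Qed.

Lemma computableQ_nat C (a : C -> nat) :
  computable a -> computableQ (fun c => (a c)%:R).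
Proof.
move=> ha; exists a, (fun=> 0%N), (fun=> 0%N); split=> //; try exact: computable_cst.
by move=> c; rewrite subr0 divr1.
Qed.

Lemma computableQ_opp C (t : C -> rat) :
  computableQ t -> computableQ (fun c => - t c).
Proof.
move=> [a [b [d [ha hb hd E]]]]; exists b, a, d; split=> // c.
by rewrite E -mulNr opprB.
Qed.

Lemma computableQ_add C (t u : C -> rat) :
  computableQ t -> computableQ u -> computableQ (fun c => t c + u c).
Proof.
move=> [a [b [d [ha hb hd E]]]] [a' [b' [d' [ha' hb' hd' E']]]].
exists (fun c => a c * (d' c).+1 + a' c * (d c).+1)%N.
exists (fun c => b c * (d' c).+1 + b' c * (d c).+1)%N.
exists (fun c => ((d c).+1 * (d' c).+1).-1)%N.
split; do ?[apply: computable_add | apply: computable_mul | apply: computable_succ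
  | apply: computable_pred] => //.
move=> c; rewrite E E' prednK ?muln_gt0// !natrD !natrM.
have h1 : (d c).+1%:R != 0 :> rat by rewrite pnatr_eq0.
have h2 : (d' c).+1%:R != 0 :> rat by rewrite pnatr_eq0.
by move: (d c).+1%:R (d' c).+1%:R h1 h2 => x y hx hy; field; rewrite hx hy.
Qed.

Lemma computableQ_sub C (t u : C -> rat) :
  computableQ t -> computableQ u -> computableQ (fun c => t c - u c).
Proof. by move=> ht /computableQ_opp hu; exact: computableQ_add. Qed.

Lemma computableQ_mul C (t u : C -> rat) :
  computableQ t -> computableQ u -> computableQ (fun c => t c * u c).
Proof.
move=> [a [b [d [ha hb hd E]]]] [a' [b' [d' [ha' hb' hd' E']]]].
exists (fun c => a c * a' c + b c * b' c)%N.
exists (fun c => a c * b' c + b c * a' c)%N.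
exists (fun c => ((d c).+1 * (d' c).+1).-1)%N.
split; do ?[apply: computable_add | apply: computable_mul | apply: computable_succ
  | apply: computable_pred] => //.
move=> c; rewrite E E' prednK ?muln_gt0// !natrD !natrM.
have h1 : (d c).+1%:R != 0 :> rat by rewrite pnatr_eq0.
have h2 : (d' c).+1%:R != 0 :> rat by rewrite pnatr_eq0.
by move: (d c).+1%:R (d' c).+1%:R h1 h2 => x y hx hy; field; rewrite hx hy.
Qed.

Lemma computableQ_divS C (t : C -> rat) (n : C -> nat) :
  computableQ t -> computable n -> computableQ (fun c => t c / (n c).+1%:R).
Proof.
move=> ht hn; apply: computableQ_mul => //.
apply: (@computableQ_ext _ (fun c => (1%:R - 0%:R) / (n c).+1%:R)).
  by move=> c; rewrite subr0 div1r.
by apply: computableQ_qval => //; exact: computable_cst.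
Qed.

(** Primitive recursion carries a single number, not the three components of a rational. Over the
    product of all denominators as common denominator, the sum becomes two sums of natural
    numbers. *)
Lemma computableQ_sum C (N : C -> nat) (t : C -> nat -> rat) :
  computable N -> computableQ (fun c : ctx_ext C => t c.1 c.2) ->
  computableQ (fun c => \sum_(0 <= j < N c) t c j).
Proof.
move=> hN [a [b [d [ha hb hd E]]]].
pose D c := (\prod_(0 <= j < N c) (d (c, j)).+1)%N.
have D0 c : (0 < D c)%N by rewrite prodn_gt0.
have hDp : computable (fun c => (D c).-1).
  apply: computable_pred; apply: computable_prod => //; apply: computable_succ.
  by apply: computable_ext hd => -[].
pose num (f : ctx_ext C -> nat) c :=
    (\sum_(0 <= j < N c) f (c, j) * ((D c).-1.+1 %/ (d (c, j)).+1))%N.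
have hM f : computable f -> computable (num f).
  move=> hf; apply: computable_sum => //; apply: (@computable_mul (ctx_ext C)).
    by apply: computable_ext hf => -[].
  apply: (@computable_divS (ctx_ext C)).
    exact: computable_succ (computable_weak hDp).
  by apply: computable_ext hd => -[].
exists (num a), (num b), (fun c => (D c).-1); split; [exact: hM | exact: hM | exact: hDp | ].
move=> c; rewrite /num prednK//.
have Dr : (D c)%:R != 0 :> rat by rewrite pnatr_eq0 -lt0n.
apply: (canRL (mulfK Dr)); rewrite big_distrl/= !natr_sum -sumrB.
apply: eq_big_nat => j /andP[_ jN]; rewrite (E (c, j)).
have dvdD : ((d (c, j)).+1 %| D c)%N.
  by rewrite /D (big_rem j) ?mem_index_iota//= dvdn_mulr.
rewrite -{1}(divnK dvdD) !natrM mulrBl.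
have h1 : (d (c, j)).+1%:R != 0 :> rat by rewrite pnatr_eq0.
by move: (d (c, j)).+1%:R h1 => x hx; field.
Qed.

Lemma computableQ_le C (t u : C -> rat) :
  computableQ t -> computableQ u -> computable (fun c => (t c <= u c)%R : nat).
Proof.
move=> ht hu; have [a [b [d [ha hb hd E]]]] := computableQ_sub ht hu.
apply: computable_ext (computable_leq ha hb) => c.
by rewrite -subr_le0 E pmulr_lle0 ?invr_gt0 ?ltr0n// subr_le0 ler_nat.
Qed.

Lemma computableQ_rat_digit C (B s i : C -> nat) :
  computable B -> computable s -> computable i ->
  computableQ (fun c => rat_digit (B c) (s c) (i c)).
Proof.
move=> hB hs hi.
have h3 : computable (fun c => 3 * i c)%N.
  by apply: computable_mul => //; exact: computable_cst.
by apply: computableQ_qval; apply: computable_digit => //; do ?apply: computable_succ.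
Qed.

End Arithmetic.

Lemma digits_surj (l : seq nat) :
  exists B s, forall i, (i < size l)%N -> digit B s i = nth 0%N l i.
Proof.
exists (\max_(x <- l) x); set B := \max_(x <- l) x.
have : all (leq^~ B) l.
  by apply/allP => x xl; rewrite /B (big_rem x xl)/= leq_maxl.
elim: l {B}(B) => [|x l IH] B /=; first by exists 0%N.
case/andP=> xB /IH [s hs]; exists (x + B.+1 * s)%N => -[|i] /=.
  by rewrite /digit expn0 divn1 => _; rewrite mulnC addnC modnMDl modn_small.
rewrite ltnS => /hs <-; rewrite /digit expnS divnMA.
suff -> : ((x + B.+1 * s) %/ B.+1 = s)%N by [].
by rewrite mulnC addnC divnMDl// divn_small// addn0.
Qed.

Lemma qval_surj (r : rat) : exists a b c : nat, r = (a%:R - b%:R) / c.+1%:R.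
Proof.
rewrite -(divq_num_den r); case: (denq r) (denq_gt0 r) => // -[|c] // _.
have [n E] : exists n, numq r = n by eexists.
rewrite E; case: n E => n _.
- by exists n, 0%N, c; rewrite subr0.
- by exists 0%N, n.+1, c; rewrite NegzE sub0r mulrNz.
Qed.

Lemma rat_digits_surj (c : nat -> rat) (n : nat) :
  exists B s, forall i, (i < n)%N -> rat_digit B s i = c i.
Proof.
have /choice[a /choice[b /choice[d E]]] : forall i, exists a b d : nat,
    c i = (a%:R - b%:R) / d.+1%:R by move=> i; exact: qval_surj.
pose f m := nth 0%N [:: a (m %/ 3); b (m %/ 3); d (m %/ 3)]%N (m %% 3).
have fE i k : (k < 3)%N -> f (3 * i + k)%N = nth 0%N [:: a i; b i; d i] k.
  by move=> k3; rewrite /f mulnC divnMDl// divn_small// addn0 modnMDl modn_small.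
have [B [s]] := digits_surj (mkseq f (3 * n)).
rewrite size_mkseq => Bs; exists B, s => i lin.
have dE k : (k < 3)%N -> digit B s (3 * i + k) = nth 0%N [:: a i; b i; d i] k.
  move=> k3; have h : (3 * i + k < 3 * n)%N by lia.
  by rewrite Bs// nth_mkseq// fE.
by rewrite /rat_digit -[(3 * i)%N]addn0 -!addnS !dE//=.
Qed.

(** * Norms and the Koopman operator *)

Section Norms.
Context d (X : measurableType d) (R : realType) (mu : probability X R).
Implicit Types (p : R) (f g : X -> R).

Definition rnorm p f : R := fine 'N[mu]_p%:E [EFin \o f]%E.

Lemma Lfun_measurable q f : f \in Lfun mu q -> measurable_fun setT f.
Proof. by rewrite inE => /andP[/[!inE]]. Qed.

Lemma rnormE p f : f \in Lfun mu p%:E -> 'N[mu]_p%:E [EFin \o f]%E = (rnorm p f)%:E.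
Proof.
rewrite inE => /andP[_ /[!inE]/= h]; rewrite /rnorm fineK//.
by rewrite ge0_fin_numE ?Lnorm_ge0.
Qed.

Lemma rnorm_ge0 p f : 0 <= rnorm p f.
Proof. by rewrite fine_ge0// Lnorm_ge0. Qed.

Lemma rnormN p f : rnorm p (\- f) = rnorm p f.
Proof.
rewrite /rnorm (_ : EFin \o _ = (\- (EFin \o f))%E)//; congr fine; exact: oppe_Lnorm.
Qed.

Lemma LfunD p f g : 1 <= p -> f \in Lfun mu p%:E -> g \in Lfun mu p%:E ->
  f \+ g \in Lfun mu p%:E.
Proof.
move=> p1 hf hg; have p1' : (1 <= p%:E)%E by rewrite lee_fin.
have [_ /(_ 1 f g hf hg)] := Lfun_submod_closed mu p1'.
by rewrite scale1r.
Qed.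

Lemma LfunZ p f (a : R) : 1 <= p -> f \in Lfun mu p%:E ->
  (fun x => a * f x) \in Lfun mu p%:E.
Proof.
move=> p1 hf; have p1' : (1 <= p%:E)%E by rewrite lee_fin.
have [h0 /(_ a f 0 hf h0)] := Lfun_submod_closed mu p1'.
by rewrite addr0.
Qed.

Lemma LfunN p f : 1 <= p -> f \in Lfun mu p%:E -> \- f \in Lfun mu p%:E.
Proof.
move=> p1 /(LfunZ (-1) p1); rewrite (_ : (fun x => -1 * f x) = \- f)//.
by apply/funext => x; rewrite mulN1r.
Qed.

Lemma LfunB p f g : 1 <= p -> f \in Lfun mu p%:E -> g \in Lfun mu p%:E ->
  f \- g \in Lfun mu p%:E.
Proof. by move=> p1 hf hg; apply: LfunD => //; exact: LfunN. Qed.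

Lemma Lfun_sum p (n : nat) (F : nat -> X -> R) : 1 <= p ->
  (forall i, F i \in Lfun mu p%:E) ->
  (fun x => \sum_(0 <= i < n) F i x) \in Lfun mu p%:E.
Proof.
move=> p1 hF; elim: n => [|n IH].
  rewrite (_ : (fun _ => _) = cst 0); first exact: Lfun_cst.
  by apply/funext => x; rewrite big_nil.
rewrite (_ : (fun _ => _) = (fun x => \sum_(0 <= i < n) F i x) \+ F n).
  exact: LfunD.
by apply/funext => x; rewrite big_nat_recr.
Qed.

Lemma rnormD p f g : 1 <= p -> f \in Lfun mu p%:E -> g \in Lfun mu p%:E ->
  rnorm p (f \+ g) <= rnorm p f + rnorm p g.
Proof.
move=> p1 hf hg; rewrite -lee_fin EFinD -!rnormE//; last exact: LfunD.
by apply: minkowski_EFin => //; [exact: Lfun_measurable hf | exact: Lfun_measurable hg].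
Qed.

Lemma rnormB p f g : 1 <= p -> f \in Lfun mu p%:E -> g \in Lfun mu p%:E ->
  rnorm p (f \- g) <= rnorm p f + rnorm p g.
Proof.
by move=> p1 hf hg; rewrite -(rnormN p g); exact: (rnormD p1 hf (LfunN p1 hg)).
Qed.

Lemma rnormBC p f g : rnorm p (f \- g) = rnorm p (g \- f).
Proof.
rewrite -rnormN; congr (rnorm _ _); apply/funext => x /=; by rewrite opprB.
Qed.

Lemma rnorm_dist p f g h : 1 <= p -> f \in Lfun mu p%:E ->
  g \in Lfun mu p%:E -> h \in Lfun mu p%:E ->
  rnorm p (f \- h) <= rnorm p (f \- g) + rnorm p (g \- h).
Proof.
move=> p1 hf hg hh.
rewrite (_ : f \- h = (f \- g) \+ (g \- h)); first by apply: rnormD => //; exact: LfunB.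
by apply/funext => x /=; rewrite addrA subrK.
Qed.

Lemma rnormZ p f (a : R) : 1 <= p -> f \in Lfun mu p%:E ->
  rnorm p (fun x => a * f x) = `|a| * rnorm p f.
Proof.
move=> p1 hf; have p1' : (1 <= p%:E)%E by rewrite lee_fin.
apply: EFin_inj; rewrite EFinM -!rnormE//; last exact: LfunZ.
by have := LnormZ (Lfun_Sub p1' hf) a; rewrite Lfun_valP.
Qed.

Lemma rnorm_sum p (n : nat) (F : nat -> X -> R) : 1 <= p ->
  (forall i, F i \in Lfun mu p%:E) ->
  rnorm p (fun x => \sum_(0 <= i < n) F i x) <= \sum_(0 <= i < n) rnorm p (F i).
Proof.
move=> p1 hF; elim: n => [|n IH].
  rewrite big_nil (_ : (fun _ => _) = cst 0).
    by rewrite /rnorm Lnorm0// eqe gt_eqF// (lt_le_trans _ p1).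
  by apply/funext => x; rewrite big_nil.
rewrite (_ : (fun _ => _) = (fun x => \sum_(0 <= i < n) F i x) \+ F n).
  rewrite big_nat_recr//=; apply: le_trans (rnormD p1 _ _) _ => //.
    exact: Lfun_sum.
  by rewrite lerD2r.
by apply/funext => x; rewrite big_nat_recr.
Qed.

Lemma rnorm1E f : f \in Lfun mu 1 -> rnorm 1 f = (\int[mu]_x `|f x|)%R.
Proof. by move=> hf; rewrite /rnorm Lnorm1. Qed.

Lemma rnorm2E f : f \in Lfun mu 2%:E -> rnorm 2 f ^+ 2 = (\int[mu]_x (f x ^+ 2))%R.
Proof.
move=> hf; apply: EFin_inj.
have := @powR_Lnorm _ _ _ mu (EFin \o f) 2 _; rewrite pnatr_eq0 => /(_ isT).
rewrite rnormE// poweR_EFin powR_mulrn ?rnorm_ge0// => ->.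
rewrite /Rintegral fineK; last first.
  apply: integrable_fin_num => //; exact: Lfun2_integrable_sqr.
apply: eq_integral => x _ /=.
by rewrite powR_mulrn// real_normK// num_real.
Qed.

Lemma Lfun21 f : f \in Lfun mu 2%:E -> f \in Lfun mu 1.
Proof. by move=> hf; apply: Lfun_subset12 => //; rewrite fin_num_measure. Qed.

Lemma Lnorm_one p : 'N[mu]_p%:E [EFin \o @cst X R 1%R]%E = 1%E.
Proof.
rewrite -[RHS](poweR1r p^-1) -[X in (X `^ _)%E](@probability_setT _ _ _ mu).
exact: (Lnorm_cst1 mu p).
Qed.

(** Hölder's inequality against the constant 1. It lets a certificate found in L2 serve the L1 rate
    and the maximal inequality as well. *)
Lemma rnorm12 f : f \in Lfun mu 2%:E -> rnorm 1 f <= rnorm 2 f.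
Proof.
move=> hf; rewrite -lee_fin -!rnormE//; last exact: Lfun21.
have m1 : measurable_fun setT (@cst X R 1) by exact: measurable_cst.
have := @hoelder _ _ _ mu f (cst 1) 2 2 (Lfun_measurable hf) m1.
rewrite !ltr0n => /(_ isT isT); rewrite [X in X = _ -> _](_ : _ = 1); last by field.
move=> /(_ erefl); rewrite (_ : (f \* @cst X R 1)%R = f); last first.
  by apply/funext => x /=; rewrite mulr1.
move=> /le_trans; apply.
by rewrite Lnorm_one mule1.
Qed.

Lemma rnorm_cst p (c : R) : 1 <= p -> rnorm p (cst c) = `|c|.
Proof.
move=> p1; have := rnormZ c p1 (Lfun_cst mu 1 p).
rewrite (_ : (fun _ => _) = cst c); last by apply/funext => x /=; rewrite mulr1.
move=> ->; rewrite /rnorm.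
by rewrite Lnorm_one mulr1.
Qed.

End Norms.

(** * Integrals, norms and averages under a measure preserving map *)

Section Invariance.
Context d (X : measurableType d) (R : realType) (mu : probability X R).
Variable tau : X -> X.
Hypothesis mp : measure_preserving mu tau.
Local Notation T := (koopman tau).
Implicit Types f g h : X -> R.

Let mtau : measurable_fun setT tau. Proof. by case: mp. Qed.

Lemma ge0_integral_koopman (F : X -> \bar R) : measurable_fun setT F ->
  (forall x, 0 <= F x)%E -> (\int[mu]_x F (tau x) = \int[mu]_x F x)%E.
Proof.
move=> mF F0.
rewrite [RHS](@eq_measure_integral _ _ _ _ (pushforward mu tau)); last first.
  by move=> A mA _; case: mp => _ h; exact: esym (h A mA).
by rewrite ge0_integral_pushforward// preimage_setT.
Qed.

Lemma Lnorm_koopman p f : measurable_fun setT f ->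
  ('N[mu]_p%:E [EFin \o T f] = 'N[mu]_p%:E [EFin \o f])%E.
Proof.
move=> mf; rewrite unlock /koopman; congr (_ `^ _)%E.
apply: (@ge0_integral_koopman (fun x => `|(f x)%:E| `^ p)%E).
  rewrite (_ : (fun x => _) = EFin \o (fun x => `|f x| `^ p)%R)//.
  apply/measurable_EFinP.
  apply: (@measurableT_comp _ _ _ _ _ _ (@powR R ^~ p)) => //.
  exact: measurableT_comp.
by move=> x; exact: poweR_ge0.
Qed.

Lemma measurable_koopman f : measurable_fun setT f -> measurable_fun setT (T f).
Proof. by move=> mf; exact: measurableT_comp. Qed.

Lemma Lfun_koopman p f : f \in Lfun mu p%:E -> T f \in Lfun mu p%:E.
Proof.
move=> hf; have mf := Lfun_measurable hf.
move: hf; rewrite !inE => /andP[_ /[!inE] hf]; apply/andP; split; rewrite inE/=.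
  exact: measurable_koopman.
by move: hf; rewrite /= /finite_norm Lnorm_koopman.
Qed.

Lemma Lfun_iter_koopman p i f : f \in Lfun mu p%:E -> iter i T f \in Lfun mu p%:E.
Proof. by move=> hf; elim: i => // i IH; exact: Lfun_koopman. Qed.

Lemma rnorm_koopman p f : f \in Lfun mu p%:E -> rnorm mu p (T f) = rnorm mu p f.
Proof. by move=> hf; rewrite /rnorm Lnorm_koopman//; exact: Lfun_measurable hf. Qed.

Lemma rnorm_iter_koopman p i f : f \in Lfun mu p%:E ->
  rnorm mu p (iter i T f) = rnorm mu p f.
Proof.
move=> hf; elim: i => // i IH; rewrite iterS rnorm_koopman//.
exact: Lfun_iter_koopman.
Qed.

Lemma Lfun_avg p n f : 1 <= p -> f \in Lfun mu p%:E -> avg tau f n \in Lfun mu p%:E.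
Proof.
move=> p1 hf; apply: (LfunZ n%:R^-1 p1); apply: Lfun_sum => // i.
exact: Lfun_iter_koopman.
Qed.

Lemma rnorm_avg p n f : 1 <= p -> f \in Lfun mu p%:E ->
  rnorm mu p (avg tau f n) <= rnorm mu p f.
Proof.
move=> p1 hf; have hi i := Lfun_iter_koopman i hf.
rewrite rnormZ//; last exact: Lfun_sum.
case: n => [|n]; first by rewrite invr0 normr0 mul0r rnorm_ge0.
rewrite ger0_norm// mulrC ler_pdivrMr//.
apply: le_trans (rnorm_sum _ p1 hi) _.
rewrite (eq_bigr (fun=> rnorm mu p f)); last by move=> i _; rewrite rnorm_iter_koopman.
by rewrite big_const_nat iter_addr_0 subn0 mulr_natr.
Qed.

Lemma integrable_koopman f : mu.-integrable setT (EFin \o f) ->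
  mu.-integrable setT (EFin \o T f).
Proof. by move=> /Lfun1_integrable/Lfun_koopman/Lfun1_integrable. Qed.

Lemma Rintegral_koopman f : mu.-integrable setT (EFin \o f) ->
  (\int[mu]_x T f x = \int[mu]_x f x)%R.
Proof.
move=> hf; congr fine.
rewrite [RHS](@eq_measure_integral _ _ _ _ (pushforward mu tau)); last first.
  by move=> A mA _; case: mp => _ h; exact: esym (h A mA).
rewrite (@integral_pushforward _ _ _ _ _ _ mtau mu setT (EFin \o f))//.
  by case/integrableP: hf.
by rewrite preimage_setT; exact: integrable_koopman.
Qed.

Lemma iter_koopmanD i f g : iter i T (f \+ g) = iter i T f \+ iter i T g.
Proof. by elim: i => //= i ->. Qed.

Lemma iter_koopman_tau i f x : iter i T f (tau x) = iter i.+1 T f x.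
Proof. by []. Qed.

Lemma avgD n f g : avg tau (f \+ g) n = avg tau f n \+ avg tau g n.
Proof.
apply/funext => x; rewrite /avg /= -mulrDr -big_split/=; congr (_ * _).
by apply: eq_bigr => i _; rewrite iter_koopmanD.
Qed.

Lemma avg_cst n (c : R) : (0 < n)%N -> avg tau (cst c) n = cst c.
Proof.
move=> n0; apply/funext => x; rewrite /avg.
rewrite (eq_bigr (fun=> c)); last first.
  by move=> i _; rewrite (_ : iter i T (cst c) = cst c)//; elim: i => //= i ->.
rewrite big_const_nat iter_addr_0 subn0 -[c *+ n]mulr_natl mulKf//.
by rewrite pnatr_eq0 -lt0n.
Qed.

Lemma avg_coboundary n h :
  avg tau (h \- T h) n = (fun x => n%:R^-1 * (h x - iter n T h x)).
Proof.
apply/funext => x; rewrite /avg; congr (_ * _).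
elim: n => [|n IH]; first by rewrite big_nil subrr.
rewrite big_nat_recr//= IH.
have -> : iter n T (h \- T h) x = iter n T h x - iter n.+1 T h x.
  rewrite iterSr; move: (T h) => g {IH}; elim: n x => //= n IHn x.
  exact: (IHn (tau x)).
by rewrite addrA subrK.
Qed.

End Invariance.

(** * The maximal ergodic theorem *)

Section Maximal.
Context d (X : measurableType d) (R : realType) (mu : probability X R).
Variable tau : X -> X.
Hypothesis mp : measure_preserving mu tau.
Local Notation T := (koopman tau).
Implicit Types f g h : X -> R.

(* The maximum of 0 and of the first [k] partial sums of the orbit of [g]. *)
Fixpoint max_sum g (k : nat) : X -> R :=
  if k is k'.+1 then fun x => Num.max 0 (g x + max_sum g k' (tau x)) else cst 0.

Lemma max_sum_ge0 g k x : 0 <= max_sum g k x.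
Proof. by case: k => //= k; rewrite le_max lexx. Qed.

Lemma max_sum_le g k x : max_sum g k x <= max_sum g k.+1 x.
Proof.
elim: k x => [|k IH] x; first exact: (max_sum_ge0 g 1).
rewrite [leLHS]/= ge_max max_sum_ge0/= [leRHS]/= le_max lerD2l.
by rewrite (le_trans (IH _))// orbT.
Qed.

Lemma sum_le_max_sum g k n x : (n <= k)%N ->
  \sum_(0 <= i < n) iter i T g x <= max_sum g k x.
Proof.
elim: k n x => [|k IH] [|n] x // nk; rewrite ?big_nil ?max_sum_ge0//.
rewrite big_nat_recl//= le_max lerD2l; apply/orP; right.
exact: (IH n (tau x)).
Qed.

Lemma integrable_max_sum g k : mu.-integrable setT (EFin \o g) ->
  mu.-integrable setT (EFin \o max_sum g k).
Proof.
move=> ig; elim: k => [|k IH] /=.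
  by apply/Lfun1_integrable; exact: Lfun_cst.
have iD : mu.-integrable setT (EFin \o (g \+ T (max_sum g k))).
  apply/Lfun1_integrable/LfunD => //; first exact/Lfun1_integrable.
  exact/Lfun_koopman/Lfun1_integrable.
apply: le_integrable (iD) => //.
  apply/measurable_EFinP; apply: measurable_maxr; first exact: measurable_cst.
  by apply/measurable_EFinP; case/integrableP: iD.
move=> x _ /=; rewrite lee_fin /koopman/=.
rewrite ger0_norm ?le_max ?lexx//.
by rewrite ge_max normr_ge0 ler_norm.
Qed.

Definition max_set g k : set X := [set x | 0 < max_sum g k x].

Lemma measurable_max_set g k : mu.-integrable setT (EFin \o g) ->
  measurable (max_set g k).
Proof.
move=> /integrable_max_sum - /(_ k) /integrableP[/measurable_EFinP m _].
have := m measurableT _ (measurable_itv `]0, +oo[).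
rewrite setTI (_ : _ @^-1` _ = max_set g k)//.
by apply/seteqP; split => x /=; rewrite in_itv/= andbT.
Qed.

(* Garsia's argument: where the maximum [m] is positive, it equals [g] plus an
   earlier maximum at [tau x], so [g >= m - T m] there. *)
Lemma maximal_ergodic g k : mu.-integrable setT (EFin \o g) ->
  0 <= \int[mu]_(x in max_set g k) g x.
Proof.
move=> ig; have im := integrable_max_sum k ig.
have mE := measurable_max_set k ig.
have iT := integrable_koopman mp im.
have <- : \int[mu]_x (max_sum g k x - T (max_sum g k) x) = 0.
  by rewrite RintegralB// Rintegral_koopman// subrr.
rewrite [leRHS]Rintegral_mkcond; apply: le_Rintegral => //.
- by apply: (integrableB measurableT im iT).
- rewrite -restrict_EFin -integrable_mkcond//.
  by apply: integrableS ig.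
move=> x _; rewrite /patch; case: ifPn => [|] xE.
  move: xE; rewrite inE /max_set /=; case: k {im mE iT} => [|k]; first by rewrite /= ltxx.
  move=> /= h; have {h} : 0 < g x + max_sum g k (tau x).
    by move: h; rewrite lt_max ltxx.
  move=> /ltW/max_idPr ->; rewrite /koopman /=.
  by rewrite lerBlDr lerD2l max_sum_le.
move: xE; rewrite notin_setE /max_set /= => /negP; rewrite -leNgt => h.
by rewrite subr_le0 (le_trans h)// max_sum_ge0.
Qed.

Lemma norm_iter_koopman f i x : `|iter i T f x| = iter i T (Num.norm \o f) x.
Proof. by elim: i x => //= i IH x; exact: IH. Qed.

(** The maximal ergodic theorem is applied to [|f| - l]: where some [|A_m f|] exceeds [l], an orbit
    sum of [|f| - l] is positive. On that set [A] it yields [l mu(A) <= int_A |f|], which is at most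
    the L1 norm. *)
Lemma maximal_weak_type f (l : R) k : 0 < l -> f \in Lfun mu 1 ->
  exists A, [/\ measurable A,
    forall x m, (0 < m <= k)%N -> l < `|avg tau f m x| -> A x &
    l * fine (mu A) <= rnorm mu 1 f].
Proof.
move=> l0 hf; pose g x := `|f x| - l.
have iaf : mu.-integrable setT (EFin \o (Num.norm \o f)).
  exact/Lfun1_integrable/Lfun_norm.
have il : mu.-integrable setT (EFin \o cst l) by exact/Lfun1_integrable/Lfun_cst.
have ig : mu.-integrable setT (EFin \o g) by exact: (integrableB measurableT iaf il).
have mE := measurable_max_set k ig.
exists (max_set g k); split => //.
  move=> x m /andP[m0 mk] lm; rewrite /max_set /=.
  apply: lt_le_trans (sum_le_max_sum g x mk).
  have mR : 0 < m%:R :> R by rewrite ltr0n.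
  rewrite (_ : \sum_(_ <= _ < _) _ = \sum_(0 <= i < m) `|iter i T f x| - l *+ m).
    rewrite subr_gt0 -mulr_natl mulrC.
    move: lm; rewrite /avg normrM normfV normr_nat.
    rewrite [X in _ < X -> _]mulrC ltr_pdivlMr// => /lt_le_trans; apply; exact: ler_norm_sum.
  rewrite -[X in l *+ X](subn0 m) -sumr_const_nat -sumrB; apply: eq_bigr => i _.
  by rewrite norm_iter_koopman; elim: i x {lm} => //= i IH x; exact: (IH (tau x)).
have := maximal_ergodic k ig; rewrite /g RintegralB//; first last.
- by apply: integrableS il.
- by apply: integrableS iaf.
rewrite Rintegral_cst// subr_ge0 => /le_trans; apply.
rewrite rnorm1E// Rintegral_mkcond; apply: le_Rintegral => //.
  rewrite -restrict_EFin -integrable_mkcond//; by apply: integrableS iaf.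
by move=> x _; rewrite /patch; case: ifPn => _ /=; rewrite ?lexx ?normr_ge0.
Qed.

End Maximal.

(** * Almost everywhere and mean convergence *)

Section Birkhoff.
Context d (X : measurableType d) (R : realType) (mu : probability X R).
Variable tau : X -> X.
Hypotheses (mp : measure_preserving mu tau) (erg : ergodic mu tau).
Local Notation T := (koopman tau).
Implicit Types f g h : X -> R.

Lemma measurable_avg f n : measurable_fun setT f -> measurable_fun setT (avg tau f n).
Proof.
move=> mf; apply: measurable_funM; first exact: measurable_cst.
apply: measurable_sum => i; elim: i => //= i IH.
exact: (measurable_koopman mp).
Qed.

Lemma avg_tau f n x : (0 < n)%N ->
  avg tau f n (tau x) = avg tau f n x + n%:R^-1 * (iter n T f x - f x).
Proof.
move=> n0; rewrite /avg -mulrDr; congr (_ * _).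
have h : f x + \sum_(0 <= i < n) iter i.+1 T f x =
    \sum_(0 <= i < n) iter i T f x + iter n T f x.
  by rewrite -(big_nat_recl n 0 (fun i => iter i T f x))// big_nat_recr.
by apply: (addrI (f x)); rewrite [LHS]h; ring.
Qed.

Lemma iter_koopman_comp f i x : iter i T f x = f (iter i tau x).
Proof. by elim: i x => //= i IH x; rewrite {1}/koopman /= IH -iterSr. Qed.

(** The set where the upper limit of the averages exceeds [c]. The gap [1 / (j + 1)] makes the
    inequality strict through countable operations, and it leaves room for the shift by [tau]. *)
Definition limsup_set f (c : R) : set X :=
  \bigcup_j \bigcap_N \bigcup_(n in [set n | (N <= n)%N])
    [set x | c + j.+1%:R^-1 < avg tau f n x].

Lemma measurable_limsup_set f c : measurable_fun setT f -> measurable (limsup_set f c).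
Proof.
move=> mf; apply: bigcup_measurable => j _; apply: bigcap_measurableType => N _.
apply: bigcup_measurable => n _.
have := @measurable_avg f n mf measurableT _ (measurable_itv `]c + j.+1%:R^-1, +oo[).
by rewrite setTI; congr measurable; apply/seteqP; split => x /=; rewrite in_itv/= andbT.
Qed.

(** [ergodic] speaks of sets equal to their preimage, so invariance has to be exact. For bounded [f]
    the averages at [x] and at [tau x] differ by at most [2 B / n], which does not affect the upper
    limit. *)
Lemma limsup_set_invariant f c (B : R) : (forall x, `|f x| <= B) ->
  tau @^-1` limsup_set f c = limsup_set f c.
Proof.
move=> fB.
have B0 : 0 <= B by exact: le_trans (normr_ge0 _) (fB point).
have close n x : (0 < n)%N ->
    `|avg tau f n (tau x) - avg tau f n x| <= n%:R^-1 * (B + B).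
  move=> n0; rewrite avg_tau// addrC addKr normrM normfV normr_nat.
  rewrite ler_wpM2l ?invr_ge0// (le_trans (ler_normB _ _))// lerD//.
  by rewrite iter_koopman_comp.
have shift x y : (forall n, (0 < n)%N ->
      `|avg tau f n x - avg tau f n y| <= n%:R^-1 * (B + B)) ->
    limsup_set f c x -> limsup_set f c y.
  (* Halving the gap, since [1 / (j + 1) = 2 / (2 j + 2)]: the lost half absorbs the difference
     [2 B / n] for large [n]. *)
  move=> xy [j _ hj]; exists (j.*2.+1) => // N _.
  have [M BM] : exists M : nat, (B + B) * (j.*2.+2)%:R < M%:R.
    by exists (Num.trunc ((B + B) * (j.*2.+2)%:R)).+1; rewrite truncnS_gt.
  have [n /= Nn hn] := hj (maxn M.+1 N) I.
  exists n => /=; first by rewrite (leq_trans _ Nn)// leq_maxr.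
  have Mn : (M < n)%N by rewrite (leq_trans _ Nn)// leq_maxl.
  have n0 : (0 < n)%N by rewrite (leq_ltn_trans _ Mn).
  have nR : 0 < n%:R :> R by rewrite ltr0n.
  have := xy n n0; rewrite ler_distl => /andP[_].
  have -> : j.*2.+2 = (j.+1 * 2)%N by rewrite muln2.
  have lt2 : n%:R^-1 * (B + B) < j.*2.+2%:R^-1 :> R.
    rewrite mulrC ltr_pdivrMr// mulrC ltr_pdivlMr ?ltr0n//.
    by rewrite (lt_trans BM)// ltr_nat.
  move: lt2 hn; have -> : j.*2.+2 = (j.+1 * 2)%N by rewrite muln2.
  rewrite natrM invfM.
  by move: (j.+1%:R^-1) (n%:R^-1 * _) => a b; lra.
apply/seteqP; split => x /=.
  by apply: shift => n n0; exact: close.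
by apply: shift => n n0; rewrite distrC; exact: close.
Qed.

(** Otherwise the set has measure 1. With [g = f - c], the sets [F k] where some orbit sum of length
    at most [k] is positive then increase to full measure. The integral of [g] over [F k] is
    nonnegative, and over the complement it is at least [- K mu(~ F k)], which tends to 0. Hence the
    integral of [f] would be at least [c]. *)
Lemma limsup_set_null f c (B : R) : measurable_fun setT f ->
  (forall x, `|f x| <= B) -> \int[mu]_x f x < c -> mu (limsup_set f c) = 0%E.
Proof.
move=> mf fB fc.
have mE := measurable_limsup_set c mf.
have [//|E1] := erg mE (limsup_set_invariant c fB); exfalso.
have i_f : mu.-integrable setT (EFin \o f).
  apply: measurable_bounded_integrable => //; first by rewrite ltey_eq fin_num_measure.
  by exists B; split; rewrite ?num_real// => M BM x _; exact: le_trans (fB x) (ltW BM).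
have ic : mu.-integrable setT (EFin \o cst c) by exact/Lfun1_integrable/Lfun_cst.
pose g := f \- cst c.
have ig : mu.-integrable setT (EFin \o g) by exact: (integrableB measurableT i_f ic).
pose F k := max_set tau g k.
have mF k : measurable (F k) by apply: (measurable_max_set mp).
have ndF : nondecreasing_seq F.
  apply/nondecreasing_seqP => k; apply/subsetPset => x; rewrite /F /max_set /=.
  by move=> /lt_le_trans; apply; exact: max_sum_le.
have EF : limsup_set f c `<=` \bigcup_k F k.
  move=> x [j _ /(_ 1%N I)[n /= n0 hn]]; exists n => //; rewrite /F /max_set /=.
  apply: lt_le_trans (sum_le_max_sum tau g x (leqnn n)).
  have nR : 0 < n%:R :> R by rewrite ltr0n.
  have : c < avg tau f n x by apply: lt_trans hn; rewrite ltrDl invr_gt0.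
  have : avg tau g n x = avg tau f n x - c.
    by rewrite (_ : g = f \+ cst (- c))// avgD /= avg_cst.
  move=> gE; rewrite -subr_gt0 -gE /avg pmulr_rgt0 ?invr_gt0//.
have F1 : mu (\bigcup_k F k) = 1%E.
  have mU : measurable (\bigcup_k F k) by exact: bigcup_measurable.
  by apply/eqP; rewrite eq_le probability_le1//= -E1 le_measure// inE.
have cvF : (mu \o F) k @[k --> \oo] --> (1%E : \bar R).
  rewrite -F1; apply: (nondecreasing_cvg_mu mF _ ndF); exact: bigcup_measurable.
have D0 : 0 < c - \int[mu]_x f x by rewrite subr_gt0.
pose K := B + `|c| + 1.
have K0 : 0 < K.
  rewrite /K ltr_wpDl// addr_ge0//.
  exact: le_trans (normr_ge0 _) (fB point).
have : exists k, fine (mu (~` F k)) * K < c - \int[mu]_x f x.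
  have := cvF; move/fine_cvgP => [_ /cvgrPdist_lt /(_ ((c - \int[mu]_x f x) / K))].
  rewrite divr_gt0// => /(_ isT) [k _ /(_ k (leqnn k))] /= h.
  exists k; rewrite -ltr_pdivlMr//; apply: le_lt_trans h.
  rewrite probability_setC// fineB ?fin_num_measure//=.
  exact: ler_norm.
case=> k hk.
have := maximal_ergodic mp k ig; rewrite -/(F k) => ge0.
have : \int[mu]_x g x = \int[mu]_(x in F k) g x + \int[mu]_(x in ~` F k) g x.
  rewrite -Rintegral_setU//; first by rewrite setUv.
  - exact: measurableC.
  - by rewrite setUv.
  - by apply/disj_setPCl.
rewrite /g RintegralB// Rintegral_cst// [X in fine X](@probability_setT _ _ _ mu) mulr1 -/g => gE.
have : - (fine (mu (~` F k)) * K) <= \int[mu]_(x in ~` F k) g x.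
  rewrite mulrC -mulNr -(Rintegral_cst mu (measurableC (mF k))).
  apply: le_Rintegral; first exact: measurableC.
  - apply: (@integrableS _ _ _ mu setT) => //; first exact: measurableC.
    exact/Lfun1_integrable/Lfun_cst.
  - apply: (@integrableS _ _ _ mu setT) => //; exact: measurableC.
  move=> x _; rewrite /g /K /=.
  have := fB x; have := ler_norm c; have := ler_norm (- f x); rewrite normrN.
  by move: `|c| `|f x| => u v; lra.
by move: hk gE ge0; lra.
Qed.

End Birkhoff.

(** * The mean ergodic theorem and approximation by coboundaries *)

Section MeanErgodic.
Context d (X : measurableType d) (R : realType) (mu : probability X R).
Variable tau : X -> X.
Hypotheses (mp : measure_preserving mu tau) (erg : ergodic mu tau).
Local Notation T := (koopman tau).
Implicit Types f g h : X -> R.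

Lemma avg_norm_le f (B : R) n x : (forall x, `|f x| <= B) -> `|avg tau f n x| <= B.
Proof.
move=> fB; have B0 : 0 <= B by exact: le_trans (normr_ge0 _) (fB x).
case: n => [|n]; first by rewrite /avg big_nil mulr0 normr0.
rewrite /avg normrM normfV normr_nat mulrC ler_pdivrMr// (le_trans (ler_norm_sum _ _ _))//.
apply: (@le_trans _ _ (\sum_(0 <= i < n.+1) B)).
  by apply: ler_sum => i _; rewrite iter_koopman_comp.
by rewrite sumr_const_nat subn0 mulr_natr.
Qed.

Lemma bounded_Lfun (p : R) f (B : R) : 1 <= p -> measurable_fun setT f ->
  (forall x, `|f x| <= B) -> f \in Lfun mu p%:E.
Proof.
move=> p1 mf fB; rewrite inE; apply/andP; split; rewrite inE//= /finite_norm.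
have p0 : 0 <= p by rewrite (le_trans _ p1).
rewrite unlock poweR_lty//; apply: (@le_lt_trans _ _ (\int[mu]_x (cst (B `^ p)%:E x))%E).
  apply: ge0_le_integral => //.
  - by move=> x _; exact: poweR_ge0.
  - rewrite (_ : (fun x => _) = EFin \o (fun x => `|f x| `^ p)%R)//.
    apply/measurable_EFinP.
    apply: (@measurableT_comp _ _ _ _ _ _ (@powR R ^~ p)) => //.
    exact: measurableT_comp.
  - move=> x _; rewrite lee_fin ge0_ler_powR// nnegrE ?normr_ge0//.
    exact: le_trans (normr_ge0 _) (fB x).
apply: integrable_lty => //; exact/Lfun1_integrable/Lfun_cst.
Qed.

Lemma ae_cvg_avg f (B : R) : measurable_fun setT f -> (forall x, `|f x| <= B) ->
  {ae mu, forall x, avg tau f n x @[n --> \oo] --> \int[mu]_x f x}.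
Proof.
move=> mf fB; set I := \int[mu]_x f x.
have i_f : mu.-integrable setT (EFin \o f).
  apply: measurable_bounded_integrable => //; first by rewrite ltey_eq fin_num_measure.
  by exists B; split; rewrite ?num_real// => M BM x _; exact: le_trans (fB x) (ltW BM).
have IN : \int[mu]_x ((\- f) x) = - I.
  rewrite -mulN1r -RintegralZl//; apply: eq_Rintegral => x _ /=; by rewrite mulN1r.
have mN : measurable_fun setT (\- f) by exact: measurableT_comp.
have NB x : `|(\- f) x| <= B by rewrite normrN.
have null j : mu.-negligible (limsup_set tau f (I + j.+1%:R^-1) `|`
                              limsup_set tau (\- f) (- I + j.+1%:R^-1)).
  apply: negligibleU; apply/negligibleP; try exact: (measurable_limsup_set mp).
    by apply: (limsup_set_null mp erg mf fB); rewrite ltrDl invr_gt0.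
  by apply: (limsup_set_null mp erg mN NB); rewrite IN ltrDl invr_gt0.
apply: negligibleS (negligible_bigcup null) => x /= nx.
apply: contrapT => hx; apply: nx; apply/cvgrPdist_le => e e0.
(* One [1 / (j + 1)] comes from the threshold above the mean, the other from the gap inside
   [limsup_set]. *)
have [j je] : exists j : nat, j.+1%:R^-1 + j.+1%:R^-1 < e.
  exists (Num.trunc (2 / e)); rewrite -mulr2n -[ltLHS]mulr_natl.
  rewrite ltr_pdivrMr// -ltr_pdivrMl// mulrC.
  exact: truncnS_gt.
have bound g c : ~ limsup_set tau g (c + j.+1%:R^-1) x ->
    exists N, forall n, (N <= n)%N -> avg tau g n x <= c + e.
  move=> hg; apply: contrapT => hN; apply: hg; exists j => // N _.
  apply: contrapT => hn; apply: hN; exists N => n Nn.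
  rewrite leNgt; apply/negP => lt_n; apply: hn; exists n => //=.
  by apply: le_lt_trans lt_n; rewrite -addrA lerD2l ltW.
have [hx1 hx2] : ~ limsup_set tau f (I + j.+1%:R^-1) x /\
    ~ limsup_set tau (\- f) (- I + j.+1%:R^-1) x.
  by split=> h; apply: hx; exists j => //; [left | right].
have [N1 h1] := bound _ _ hx1; have [N2 h2] := bound _ _ hx2.
exists (maxn N1 N2) => // n /=; rewrite geq_max => /andP[/h1 l1 /h2 l2].
rewrite distrC ler_distl; apply/andP; split=> //.
have E : avg tau (\- f) n x = - avg tau f n x.
  rewrite /avg -mulrN -sumrN; congr (_ * _); apply: eq_bigr => i _.
  by rewrite !iter_koopman_comp.
by move: l2; rewrite E lerNl opprD opprK.
Qed.

Lemma mean_ergodic_bounded f (B : R) : measurable_fun setT f ->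
  (forall x, `|f x| <= B) -> forall e : R, 0 < e ->
  exists2 n, (0 < n)%N & rnorm mu 2 (avg tau f n \- cst (\int[mu]_x f x)) < e.
Proof.
move=> mf fB e e0; set I := \int[mu]_x f x.
have hf : f \in Lfun mu 2%:E by apply: bounded_Lfun fB => //; rewrite ler1n.
have hF n : avg tau f n \- cst I \in Lfun mu 2%:E.
  by apply: LfunB; rewrite ?ler1n//; [apply: Lfun_avg; rewrite ?ler1n | exact: Lfun_cst].
pose F n x := (((avg tau f n \- cst I) x) ^+ 2)%:E.
have mF n : measurable_fun setT (F n).
  apply/measurable_EFinP/measurable_funX; exact: Lfun_measurable (hF n).
have F0 : {ae mu, forall x, setT x -> F ^~ x @ \oo --> cst (0%E : \bar R) x}.
  have := ae_cvg_avg mf fB; apply: filterS => x cx _.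
  have c1 : (avg tau f n x - I) @[n --> \oo] --> (0 : R).
    by rewrite -(subrr I); apply: cvgB; [exact: cx | exact: cvg_cst].
  have := cvgM c1 c1; rewrite mulr0 => c2.
  apply/fine_cvgP; split; first by exists 0%N.
  rewrite (_ : fine \o _ = (fun n => (avg tau f n x - I) * (avg tau f n x - I)))//.
  exact: c2.
have Fb : {ae mu, forall x n, setT x ->
    (`|F n x| <= cst ((B + `|I|) ^+ 2)%:E x)%E}.
  apply: aeW => x n _; rewrite /F /= lee_fin normrX lerXn2r ?nnegrE//.
    by rewrite addr_ge0// (le_trans (normr_ge0 _) (fB x)).
  by rewrite (le_trans (ler_normB _ _))// lerD2r avg_norm_le.
have iB : mu.-integrable setT (cst ((B + `|I|) ^+ 2)%:E).
  exact/Lfun1_integrable/Lfun_cst.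
have [_ _] := dominated_convergence measurableT mF (measurable_cst _) F0 iB Fb.
rewrite integral0 => /fine_cvgP[_ /cvgrPdist_lt/(_ (e ^+ 2))].
rewrite exprn_gt0// => /(_ isT)[N _ /(_ N.+1 (leqnSn N))] /=.
rewrite sub0r normrN => h; exists N.+1 => //.
rewrite -(@ltr_pXn2r _ 2)// ?nnegrE ?rnorm_ge0 ?ltW// rnorm2E//.
exact: le_lt_trans (ler_norm _) h.
Qed.

Lemma truncation f (e : R) : f \in Lfun mu 2%:E -> 0 < e ->
  exists g, exists B : R, [/\ measurable_fun setT g, forall x, `|g x| <= B &
    rnorm mu 2 (f \- g) < e].
Proof.
move=> hf e0; have mf := Lfun_measurable hf.
pose g (M : nat) x := Num.max (- M%:R) (Num.min (f x) M%:R).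
have gB M x : `|g M x| <= M%:R.
  rewrite /g ler_norml le_max lexx/= ge_max ge_min lexx orbT andbT.
  by rewrite (le_trans (_ : _ <= 0)) ?oppr_le0.
have mg M : measurable_fun setT (g M).
  by apply: measurable_maxr => //; apply: measurable_minr.
have g_le M x : `|f x - g M x| <= `|f x|.
  rewrite /g; have M0 : 0 <= M%:R :> R by [].
  move: (f x) (M%:R) M0 => y m m0.
  have [ym|ym] := leP y m; have [ym'|ym'] := leP (- m) _.
  - by rewrite subrr normr0.
  - rewrite !ltr0_norm; lra.
  - rewrite !ger0_norm; lra.
  - lra.
have hg M : f \- g M \in Lfun mu 2%:E.
  by apply: LfunB; rewrite ?ler1n//; apply: bounded_Lfun (gB M); rewrite ?ler1n.
pose F n x := (((f \- g n) x) ^+ 2)%:E.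
have mF n : measurable_fun setT (F n).
  apply/measurable_EFinP/measurable_funX; exact: Lfun_measurable (hg n).
have F0 : {ae mu, forall x, setT x -> F ^~ x @ \oo --> cst (0%E : \bar R) x}.
  apply: aeW => x _; apply: cvg_near_cst.
  exists (Num.trunc `|f x|).+1 => // n /= hn.
  have fn : `|f x| <= n%:R.
    by rewrite (le_trans (ltW (truncnS_gt _)))// ler_nat.
  rewrite /F /g /=; move: fn; rewrite ler_norml => /andP[l1 l2].
  by rewrite min_l// max_r// subrr expr0n.
have iB : mu.-integrable setT (EFin \o (fun x => f x ^+ 2)).
  exact: Lfun2_integrable_sqr.
have Fb : {ae mu, forall x n, setT x -> (`|F n x| <= (EFin \o (fun x => (f x ^+ 2)%R)) x)%E}.
  apply: aeW => x n _; rewrite /F /= lee_fin normrX -[leRHS]real_normK ?num_real//.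
  by rewrite lerXn2r ?nnegrE// g_le.
have [_ _] := dominated_convergence measurableT mF (measurable_cst _) F0 iB Fb.
rewrite integral0 => /fine_cvgP[_ /cvgrPdist_lt/(_ (e ^+ 2))].
rewrite exprn_gt0// => /(_ isT)[N _ /(_ N (leqnn N))] /=.
rewrite sub0r normrN => h; exists (g N), N%:R; split => //.
rewrite -(@ltr_pXn2r _ 2)// ?nnegrE ?rnorm_ge0 ?ltW// rnorm2E//.
exact: le_lt_trans (ler_norm _) h.
Qed.

(** The constant is the mean of a truncation of [f], and the passage from the truncation to [f]
    costs no more than their distance because averaging is a contraction. Any constant is good
    enough later on, as the rates compare averages with each other. *)
Lemma mean_ergodic f (e : R) : f \in Lfun mu 2%:E -> 0 < e ->
  exists (c : R) (n : nat), (0 < n)%N /\ rnorm mu 2 (avg tau f n \- cst c) < e.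
Proof.
move=> hf e0; have e2 : 0 < e / 2 by rewrite divr_gt0.
have [g [B [mg gB fg]]] := truncation hf e2.
have hg : g \in Lfun mu 2%:E by apply: bounded_Lfun gB; rewrite ?ler1n.
have [n n0 hn] := mean_ergodic_bounded mg gB e2.
exists (\int[mu]_x g x), n; split => //.
have p1 : 1 <= 2 :> R by rewrite ler1n.
apply: le_lt_trans (rnorm_dist p1 (Lfun_avg mp n p1 hf) (Lfun_avg mp n p1 hg) (Lfun_cst _ _ _)) _.
rewrite [ltRHS]splitr ltrD//; apply: le_lt_trans fg.
have -> : avg tau f n \- avg tau g n = avg tau (f \- g) n.
  have := avgD tau n (f \- g) g; rewrite (_ : (f \- g) \+ g = f).
    by move=> ->; apply/funext => x /=; rewrite addrK.
  by apply/funext => x /=; rewrite subrK.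
by apply: rnorm_avg => //; exact: LfunB.
Qed.

(* [f - A_n f = (I - T) h] for [h] the mean over [i < n] of the sums of the
   first [i] terms of the orbit of [f]. *)
Lemma coboundary_approx f (e : R) : f \in Lfun mu 2%:E -> 0 < e ->
  exists (c : R) h, h \in Lfun mu 2%:E /\
    rnorm mu 2 (f \- cst c \- (h \- T h)) < e.
Proof.
move=> hf e0; have [c [n [n0 hn]]] := mean_ergodic hf e0.
pose h x := n%:R^-1 * \sum_(0 <= i < n) \sum_(0 <= j < i) iter j T f x.
have p1 : 1 <= 2 :> R by rewrite ler1n.
exists c, h; split.
  apply: LfunZ => //; apply: Lfun_sum => // i; apply: Lfun_sum => // j.
  exact: Lfun_iter_koopman.
suff -> : f \- cst c \- (h \- T h) = avg tau f n \- cst c by [].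
apply/funext => x /=; rewrite addrAC; congr (_ - _).
rewrite /h {1}/koopman /= -mulrBr -sumrB.
have -> : \sum_(0 <= i < n) (\sum_(0 <= j < i) iter j T f x -
    \sum_(0 <= j < i) iter j T f (tau x)) = \sum_(0 <= i < n) (f x - iter i T f x).
  apply: eq_bigr => i _; rewrite -sumrB.
  elim: i => [|i IH]; first by rewrite big_nil subrr.
  by rewrite big_nat_recr//= IH iter_koopman_tau iterS; ring.
rewrite sumrB sumr_const_nat subn0 mulrBr -[f x *+ n]mulr_natl mulKf ?pnatr_eq0 -?lt0n//.
by rewrite subKr.
Qed.

End MeanErgodic.

(** * Explicit rates *)

Section ProbabilityBounds.
Context d (X : measurableType d) (R : realType) (mu : probability X R).
Implicit Types (A B : set X) (f g h : X -> R).

Definition pr A : R := fine (mu A).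

Lemma prE A : measurable A -> mu A = (pr A)%:E.
Proof. by move=> mA; rewrite /pr fineK// fin_num_measure. Qed.

Lemma le_pr A B : measurable A -> measurable B -> A `<=` B -> pr A <= pr B.
Proof. by move=> mA mB AB; rewrite -lee_fin -!prE// le_measure// inE. Qed.

Lemma prU A B : measurable A -> measurable B -> pr (A `|` B) <= pr A + pr B.
Proof.
move=> mA mB; rewrite -lee_fin EFinD -!prE//; last exact: measurableU.
exact: measureU2.
Qed.

Lemma pr_bigcup (F : nat -> set X) n : (forall i, measurable (F i)) ->
  pr (\bigcup_(i < n) F i) <= \sum_(0 <= i < n) pr (F i).
Proof.
move=> mF; elim: n => [|n IH].
  by rewrite bigcup_mkord big_ord0 big_nil /pr measure0.
rewrite bigcup_mkord big_ord_recr/= -bigcup_mkord big_nat_recr//=.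
apply: le_trans (prU _ _) _ => //; first exact: bigcup_measurable.
by rewrite lerD2r.
Qed.

Lemma measurable_norm_gt f (a : R) : measurable_fun setT f ->
  measurable [set x | a < `|f x|].
Proof.
move=> mf; have mn : measurable_fun setT (fun x => `|f x|) by exact: measurableT_comp.
have := mn measurableT _ (measurable_itv `]a, +oo[).
by rewrite setTI; congr measurable; apply/seteqP; split => x /=; rewrite in_itv/= andbT.
Qed.

Lemma chebyshev_L2 f (a : R) : 0 < a -> f \in Lfun mu 2%:E ->
  pr [set x | a < `|f x|] <= rnorm mu 2 f ^+ 2 / a ^+ 2.
Proof.
move=> a0 hf; have mE := measurable_norm_gt a (Lfun_measurable hf).
have a2 : 0 < a ^+ 2 by rewrite exprn_gt0.
have i2 := Lfun2_integrable_sqr hf.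
rewrite ler_pdivlMr// mulrC -(Rintegral_cst mu mE) rnorm2E// Rintegral_mkcond.
apply: le_Rintegral => //.
  rewrite -restrict_EFin -integrable_mkcond//; apply: (@integrableS _ _ _ mu setT) => //.
  exact/Lfun1_integrable/Lfun_cst.
move=> x _; rewrite /patch; case: ifPn; last by rewrite sqr_ge0.
rewrite inE /= => h; rewrite -[leRHS]real_normK ?num_real//.
by rewrite lerXn2r ?nnegrE// ltW.
Qed.

Lemma sum_inv_sqr n k : (0 < n)%N ->
  \sum_(0 <= i < k) (n + i)%:R ^- 2 <= 2 / n%:R :> R.
Proof.
move=> n0; have nR : 1 <= n%:R :> R by rewrite ler1n.
(* Strengthened for the induction: [1 / (y + 1)^2 <= 1 / y - 1 / (y + 1)] makes the right-hand side
   telescope. *)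
suff : \sum_(0 <= i < k.+1) (n + i)%:R ^- 2 <= 2 / n%:R - (n + k)%:R^-1 :> R.
  rewrite big_nat_recr//= => h.
  apply: le_trans (le_trans h _); first by rewrite lerDl invr_ge0 exprn_ge0.
  by rewrite lerBlDr lerDl invr_ge0.
elim: k => [|k IH].
  rewrite big_nat1 addn0 [X in _ <= X](_ : _ = n%:R^-1); last by field; rewrite gt_eqF// ltr0n.
  rewrite lef_pV2 ?posrE ?exprn_gt0 ?ltr0n//.
  by rewrite expr2 ler_peMl.
rewrite big_nat_recr//=; apply: le_trans (lerD IH (lexx _)) _.
rewrite -addrA lerD2l addnS -natr1; move: (ler1n R (n + k)).
rewrite addn_gt0 n0 /= => /idP h; move: ((n + k)%:R) h => y y1.
have y0 : 0 < y by rewrite (lt_le_trans ltr01).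
have y2 : 0 < y + 1 by rewrite ltr_wpDr.
rewrite -subr_ge0 [X in 0 <= X](_ : _ = (y * (y + 1) ^+ 2)^-1).
  by rewrite invr_ge0 mulr_ge0 ?sqr_ge0// ltW.
by field; rewrite !gt_eqF.
Qed.

Lemma lt_bigmax0 (F : nat -> R) (l : R) m n : 0 <= l ->
  (l < \big[Num.max/0]_(m <= i < n) F i) = has (fun i => l < F i) (index_iota m n).
Proof.
move=> l0; elim: (index_iota m n) => [|i s IH]; first by rewrite big_nil ltNge l0.
by rewrite big_cons lt_max IH.
Qed.

End ProbabilityBounds.

(** * Rates read off from a decomposition of [f] *)

Section Decomposition.
Context d (X : measurableType d) (R : realType) (mu : probability X R).
Variable tau : X -> X.
Hypothesis mp : measure_preserving mu tau.
Local Notation T := (koopman tau).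
Variables (f h : X -> R) (c : R).
Let r := f \- cst c \- (h \- T h).

Lemma avg_decomposition n : (0 < n)%N ->
  avg tau f n \- cst c = (fun x => n%:R^-1 * (h x - iter n T h x)) \+ avg tau r n.
Proof.
move=> n0; rewrite -avg_coboundary -(avg_cst tau c n0).
have <- : (h \- T h) \+ r \+ cst c = f.
  by apply/funext => x /=; rewrite /r /=; ring.
by rewrite !avgD; apply/funext => x /=; rewrite addrK.
Qed.

Lemma rnorm_avg_decomposition p n : (0 < n)%N -> 1 <= p ->
  f \in Lfun mu p%:E -> h \in Lfun mu p%:E ->
  rnorm mu p (avg tau f n \- cst c) <= 2 * rnorm mu p h / n%:R + rnorm mu p r.
Proof.
move=> n0 p1 hf hh; rewrite avg_decomposition//.
have hi := Lfun_iter_koopman mp n hh.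
have hr : r \in Lfun mu p%:E.
  by apply: LfunB => //; apply: LfunB => //; [exact: Lfun_cst | exact: Lfun_koopman].
have hB : h \- iter n T h \in Lfun mu p%:E by exact: LfunB.
apply: le_trans (rnormD p1 (LfunZ _ p1 hB) (Lfun_avg mp n p1 hr)) _.
apply: lerD; last exact: rnorm_avg.
rewrite (rnormZ _ p1 hB) normfV normr_nat mulrC ler_wpM2r ?invr_ge0//.
by rewrite (le_trans (rnormB p1 hh hi))// rnorm_iter_koopman// mulr2n mulrDl mul1r.
Qed.

(** For [n >= M], the coboundary term [2 |h| / n] and the residual are each at most
    [1 / (4 (k + 1))], the first one strictly thanks to [t.+1]. So every such average is within
    [1 / (2 (k + 1))] of [c], and two of them are within [1 / (k + 1)] of each other. *)
Lemma norm_rate p (k t m : nat) : 1 <= p ->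
  f \in Lfun mu p%:E -> h \in Lfun mu p%:E ->
  rnorm mu p r <= (4 * k.+1)%:R^-1 -> rnorm mu p h <= t%:R ->
  let M := (8 * t.+1 * k.+1)%N in (M <= m)%N ->
  rnorm mu p (avg tau f m \- avg tau f M) < k.+1%:R^-1.
Proof.
move=> p1 hf hh hr ht M Mm.
have M0 : (0 < M)%N by rewrite !muln_gt0.
have bound n : (M <= n)%N -> rnorm mu p (avg tau f n \- cst c) < (2 * k.+1)%:R^-1.
  move=> Mn; have n0 := leq_trans M0 Mn.
  apply: le_lt_trans (rnorm_avg_decomposition n0 p1 hf hh) _.
  have n1 : 2 * rnorm mu p h / n%:R < (4 * k.+1)%:R^-1.
    rewrite ltr_pdivrMr ?ltr0n// ltr_pdivlMl ?ltr0n//.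
    apply: (@lt_le_trans _ _ M%:R); last by rewrite ler_nat.
    rewrite /M !natrM -!natr1; have := ler0n R k; move: ht (ler0n R t).
    by move: (k%:R) (t%:R) (rnorm mu p h) => K Z N; nra.
  apply: lt_le_trans (ltr_leD n1 hr) _.
  rewrite -mulr2n -[X in X <= _]mulr_natl (_ : (4 * k.+1 = 2 * (2 * k.+1))%N); last by lia.
  by rewrite natrM invfM mulVKf.
apply: le_lt_trans (rnorm_dist p1 (Lfun_avg mp m p1 hf) (Lfun_cst _ c _) (Lfun_avg mp M p1 hf)) _.
rewrite (rnormBC mu p (cst c)); apply: lt_le_trans (ltrD (bound _ Mm) (bound _ (leqnn M))) _.
by rewrite -mulr2n -[X in X <= _]mulr_natl natrM invfM mulVKf.
Qed.

(** Put [a = 1 / (k1 + 1)]. Outside [A] the averages of the residual are at most [a / 4]; outside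
    [C0] and the [C i] both [h] and [T^m h] are at most [m a / 8]. There every average from [n] to
    [k] is within [a / 2] of [c], and two of them differ by at most [a <= l]. The maximal inequality
    gives [A] measure at most half of [1 / (k2 + 1)]. By Chebyshev's inequality the other sets
    together have measure at most [(1 + 2) 64 t^2 / (a^2 n)], and [384 = 2 * 3 * 64] turns this into
    the other half. It matters that [h] is in L2 even when [f] is only in L1: a bound of order
    [1 / m] would not be summable. *)
Lemma pointwise_rate (k1 k2 t k : nat) (l : R) :
  f \in Lfun mu 1 -> h \in Lfun mu 2%:E ->
  rnorm mu 1 r <= (8 * k1.+1 * k2.+1)%:R^-1 -> rnorm mu 2 h <= t%:R ->
  k1.+1%:R^-1 <= l ->
  let n := (384 * (t.+1 ^ 2 * k1.+1 ^ 2) * k2.+1)%N in (n <= k)%N ->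
  (mu [set x | (l < \big[Num.max/0]_(n <= m < k.+1) `|avg tau f m x - avg tau f n x|)%R]
    <= (k2.+1%:R^-1)%:E)%E.
Proof.
move=> hf hh hr ht hl n nk.
have n0 : (0 < n)%N by rewrite !muln_gt0 ?expn_gt0.
have nR : 0 < n%:R :> R by rewrite ltr0n.
pose a : R := k1.+1%:R^-1.
have a0 : 0 < a by rewrite invr_gt0.
have hr1 : r \in Lfun mu 1.
  apply: LfunB => //; first by apply: LfunB => //; exact: Lfun_cst.
  by apply/Lfun21/LfunB; rewrite ?ler1n//; exact: Lfun_koopman.
have mavg m : measurable_fun setT (avg tau f m).
  by apply: (measurable_avg mp); exact: Lfun_measurable hf.
have mS : measurable
    [set x | l < \big[Num.max/0]_(n <= m < k.+1) `|avg tau f m x - avg tau f n x|].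
  rewrite (_ : [set x | _] = \bigcup_(m in [set m | m \in index_iota n k.+1])
      [set x | l < `|avg tau f m x - avg tau f n x|]).
    apply: bigcup_measurable => m _; apply: measurable_norm_gt.
    exact: measurable_funB.
  apply/seteqP; split => x /=; rewrite lt_bigmax0 ?(le_trans (ltW a0))//.
    by move=> /hasP[m mi lm]; exists m.
  by move=> [m mi lm]; apply/hasP; exists m.
have a4 : 0 < a / 4 by rewrite divr_gt0.
have [A [mA hA pA]] := maximal_weak_type mp k a4 hr1.
pose C0 := [set x | n%:R * a / 8 < `|h x|].
pose C i := [set x | (n + i)%:R * a / 8 < `|iter (n + i) T h x|].
have hi i : iter i T h \in Lfun mu 2%:E by exact: Lfun_iter_koopman.
have mC0 : measurable C0 by apply: measurable_norm_gt; exact: Lfun_measurable hh.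
have mC i : measurable (C i).
  by apply: measurable_norm_gt; exact: Lfun_measurable (hi _).
pose U := \bigcup_(i < (k.+1 - n)%N) C i.
have mU : measurable U by exact: bigcup_measurable.
have sub : [set x | l < \big[Num.max/0]_(n <= m < k.+1)
    `|avg tau f m x - avg tau f n x|] `<=` A `|` (C0 `|` U).
  move=> x /=; rewrite lt_bigmax0 ?(le_trans (ltW a0))// => /hasP[m].
  rewrite mem_index_iota ltnS => /andP[nm mk] lm.
  apply: contrapT => /not_orP[nA /not_orP[nC0 nU]].
  have part i : (n <= i <= k)%N -> `|avg tau f i x - c| <= a / 2.
    move=> /andP[ni ik]; have i0 := leq_trans n0 ni.
    have iR : 0 < i%:R :> R by rewrite ltr0n.
    have /(congr1 (fun g => g x)) /= -> := avg_decomposition i0.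
    have rle : `|avg tau r i x| <= a / 4.
      by rewrite leNgt; apply/negP => /(hA x i) hAx; apply/nA/hAx; rewrite i0.
    have hle : `|h x| <= i%:R * (a / 8).
      apply: (@le_trans _ _ (n%:R * a / 8)).
        by rewrite leNgt; apply/negP => /nC0.
      by rewrite -mulrA ler_wpM2r ?ler_nat// divr_ge0// ltW.
    have Thle : `|iter i T h x| <= i%:R * (a / 8).
      rewrite leNgt; apply/negP => hlt; apply: nU; exists (i - n)%N => /=.
        by rewrite ltn_sub2r// ltnS.
      by rewrite /C /mkset subnKC// -mulrA.
    apply: le_trans (ler_normD _ _) _.
    have : `|i%:R^-1 * (h x - iter i T h x)| <= a / 4.
      rewrite normrM normfV normr_nat ler_pdivrMl//.
      apply: le_trans (ler_normB _ _) _; apply: le_trans (lerD hle Thle) _.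
      by rewrite -mulrDr ler_wpM2l//; lra.
    by move: rle; lra.
  have := ler_distD c (avg tau f m x) (avg tau f n x); rewrite (distrC c).
  have := part m; rewrite nm mk => /(_ isT); have := part n; rewrite leqnn nk => /(_ isT).
  move: lm hl; rewrite -/a; lra.
have mAU : measurable (A `|` (C0 `|` U)) by do 2 apply: measurableU => //.
rewrite (prE mu mS) lee_fin; apply: le_trans (le_pr mu mS mAU sub) _.
have pA' : pr mu A <= (2 * k2.+1)%:R^-1.
  have : a / 4 * pr mu A <= (8 * k1.+1 * k2.+1)%:R^-1 by exact: le_trans pA hr.
  rewrite /a !natrM !invfM; have := ltr0n R k1.+1; rewrite ltr0Sn => k10.
  move=> hle; rewrite -(@ler_pM2l _ (k1.+1%:R^-1 / 4)) ?divr_gt0 ?invr_gt0//.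
  apply: le_trans hle _; rewrite le_eqVlt; apply/orP; left; apply/eqP.
  by move: (k1.+1%:R^-1) (k2.+1%:R^-1) => u v; field.
have pC g i : (n <= i)%N -> g \in Lfun mu 2%:E -> rnorm mu 2 g <= t%:R ->
    pr mu [set x | i%:R * a / 8 < `|g x|] <= 64 * t%:R ^+ 2 / a ^+ 2 * i%:R ^- 2.
  move=> ni hg gt; have iR : 0 < i%:R :> R by rewrite ltr0n (leq_trans n0).
  apply: le_trans (chebyshev_L2 _ hg) _; first by rewrite divr_gt0// mulr_gt0.
  have -> : 64 * t%:R ^+ 2 / a ^+ 2 * i%:R ^- 2 = t%:R ^+ 2 / (i%:R * a / 8) ^+ 2.
    by field; rewrite !gt_eqF.
  rewrite ler_wpM2r ?invr_ge0 ?sqr_ge0// lerXn2r ?nnegrE ?rnorm_ge0//.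
have pU : pr mu U <= 64 * t%:R ^+ 2 / a ^+ 2 * (2 / n%:R).
  apply: le_trans (pr_bigcup mu _ mC) _.
  apply: le_trans (ler_sum _ _ : _ <= \sum_(0 <= i < (k.+1 - n)%N) 64 * t%:R ^+ 2 / a ^+ 2 * (n + i)%:R ^- 2) _.
    move=> i _; apply: pC => //; first exact: leq_addr.
    by rewrite rnorm_iter_koopman.
  rewrite -mulr_sumr ler_wpM2l ?sum_inv_sqr//.
  by rewrite !mulr_ge0 ?invr_ge0 ?sqr_ge0.
have pC0 : pr mu C0 <= 64 * t%:R ^+ 2 / a ^+ 2 * (1 / n%:R).
  apply: le_trans (pC h n _ _ _) _ => //; rewrite ler_wpM2l//.
    by rewrite !mulr_ge0 ?invr_ge0 ?sqr_ge0.
  by rewrite div1r lef_pV2 ?posrE ?exprn_gt0// expr2 ler_peMl// ler1n.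
apply: le_trans (prU mu mA (measurableU _ _ mC0 mU)) _.
apply: le_trans (lerD pA' (le_trans (prU mu mC0 mU) (lerD pC0 pU))) _.
rewrite -mulrDr -mulrDl.
have : 64 * t%:R ^+ 2 / a ^+ 2 * ((1 + 2) / n%:R) <= (2 * k2.+1)%:R^-1.
  rewrite (_ : 64 * t%:R ^+ 2 / a ^+ 2 * ((1 + 2) / n%:R) =
    192 * (t%:R ^+ 2 * k1.+1%:R ^+ 2) / n%:R); last by rewrite /a; field; rewrite !gt_eqF.
  rewrite ler_pdivrMr// ler_pdivlMl ?ltr0n// /n !natrM.
  have t1 : t%:R ^+ 2 <= t.+1%:R ^+ 2 :> R by rewrite lerXn2r ?nnegrE// ler_nat.
  have K2 : 0 <= k2.+1%:R :> R by [].
  rewrite [leRHS](_ : _ =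
    2 * k2.+1%:R * (192 * (t.+1%:R ^+ 2 * k1.+1%:R ^+ 2))); last by ring.
  by rewrite ler_wpM2l ?mulr_ge0// ler_wpM2l// ler_wpM2r ?sqr_ge0.
move/(lerD (lexx (2 * k2.+1)%:R^-1))/le_trans; apply.
by rewrite -mulr2n -[X in X <= _]mulr_natl natrM invfM mulVKf.
Qed.

End Decomposition.

(** * Certificates *)

(** The rate is queried at the fraction [posq 0 q], which is [1 / (q + 1)]. *)
Definition approx_real (v : baire) (q : nat) : rat :=
  qval (part 0 v) [:: part 1 v [:: 0%N; q]].

Definition l2_index (v : baire) (q : nat) : nat := part 2 v [:: 0%N; q].
Definition l2_len (v : baire) (q : nat) : nat := part 0 v [:: l2_index v q].
Definition l2_coef (v : baire) (q i : nat) : rat :=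
  qval (part 1 v) [:: l2_index v q; i].

Lemma posq0 q : posq 0 q = q.+1%:R^-1.
Proof. by rewrite /posq div1r. Qed.

Lemma posq_gt0 p q : 0 < posq p q.
Proof. by rewrite /posq divr_gt0. Qed.

Section Representations.
Context d (X : measurableType d) (R : realType) (mu : probability X R).
Implicit Types (f g h : X -> R).

Lemma ratr_inv_nat n : ratr (n%:R^-1) = n%:R^-1 :> R.
Proof. by rewrite fmorphV /= ratr_nat. Qed.

Lemma approx_realP (x : R) v q : rep_real x v ->
  `|x - ratr (approx_real v q)| <= q.+1%:R^-1.
Proof.
case=> cv [r hr E]; rewrite /approx_real E.
have [_ hd] := hr _ (posq_gt0 0 q).
rewrite -ratr_inv_nat -posq0; apply/ler_addgt0Pl => a a0.
have /cvgrPdist_lt /(_ a a0)[N _ hN] := cv.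
have := hN (maxn N (r (posq 0 q))) (leq_maxl _ _).
have := hd (maxn N (r (posq 0 q))) (leq_maxr _ _).
rewrite lte_fin /= => h1 h2; apply: le_trans (ler_distD _ _ _) _.
by apply: ltW; apply: ltrD h2 h1.
Qed.

(** A rate controls differences of terms. A term far out is arbitrarily close to the limit, so the
    bound passes to the limit, without strictness. *)
Lemma rate_limit p (u : nat -> X -> R) f (r : rat -> nat) (e : rat) : 1 <= p ->
  (forall n, u n \in Lfun mu p%:E) -> f \in Lfun mu p%:E ->
  Lconv mu p%:E u f -> rate_bound (Ldist mu p%:E u) r -> 0 < e ->
  rnorm mu p (f \- u (r e)) <= ratr e.
Proof.
move=> p1 hu hf cv hr e0; have [_ hd] := hr e e0.
apply/ler_addgt0Pl => a a0.
have /fine_cvgP[_ /cvgrPdist_lt /(_ a a0)[N _ hN]] := cv.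
have := hN (maxn N (r e)) (leq_maxl _ _); rewrite /= sub0r normrN => h1.
have := hd (maxn N (r e)) (leq_maxr _ _).
rewrite /Ldist rnormE ?LfunB// lte_fin => h2.
apply: le_trans (rnorm_dist p1 hf (hu (maxn N (r e))) (hu _)) _.
apply: lerD; last exact: ltW.
rewrite rnormBC; apply: ltW; apply: le_lt_trans h1; exact: ler_norm.
Qed.

Variable b : nat -> X -> R.
Hypothesis hb : forall i, b i \in Lfun mu 2%:E.

Let p2 : 1 <= 2 :> R. Proof. by rewrite ler1n. Qed.

Lemma Lfun_lincomb n c : lincomb b n c \in Lfun mu 2%:E.
Proof. by apply: Lfun_sum => // i; exact: LfunZ. Qed.

Lemma l2_approxP f v q : f \in Lfun mu 2%:E -> rep_L2 mu b f v ->
  rnorm mu 2 (f \- lincomb b (l2_len v q) (l2_coef v q)) <= q.+1%:R^-1.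
Proof.
move=> hf [cv [r hr E]]; rewrite -ratr_inv_nat -posq0.
have := rate_limit p2 (fun n => Lfun_lincomb _ _) hf cv hr (posq_gt0 0 q).
by rewrite /l2_len /l2_coef /l2_index E.
Qed.

Lemma Rintegral_sum n (F : nat -> X -> R) :
  (forall i, F i \in Lfun mu 1) ->
  \int[mu]_x (\sum_(0 <= i < n) F i x) = \sum_(0 <= i < n) \int[mu]_x F i x :> R.
Proof.
move=> hF; elim: n => [|n IH].
  rewrite big_nil -[RHS](mulr0 (fine (mu setT))) mulrC -Rintegral_cst//.
  by apply: eq_Rintegral => x _; rewrite big_nil.
rewrite big_nat_recr//= -IH -RintegralD//; last 2 first.
- by apply/Lfun1_integrable/(Lfun_sum (p := 1)).
- exact/Lfun1_integrable.
by apply: eq_Rintegral => x _; rewrite big_nat_recr.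
Qed.

(** The constant is kept apart because it need not be a finite combination of the basis. The means
    of the [b i] supply the cross term, and total mass 1 the last one. *)
Lemma rnorm2_affine n (z : nat -> R) (a : R) :
  rnorm mu 2 ((fun x => \sum_(0 <= i < n) z i * b i x) \- cst a) ^+ 2 =
  \sum_(0 <= i < n) \sum_(0 <= j < n) z i * z j * \int[mu]_x (b i x * b j x)
  - 2 * a * \sum_(0 <= i < n) z i * \int[mu]_x b i x + a ^+ 2.
Proof.
have hbb i j : (fun x => b i x * b j x) \in Lfun mu 1.
  exact: (Lfun2_mul_Lfun1 (hb i) (hb j)).
have hb1 i : b i \in Lfun mu 1 by exact: Lfun21.
have q1 : 1 <= 1 :> R by [].
have hs : (fun x => \sum_(0 <= i < n) z i * b i x) \in Lfun mu 2%:E.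
  by apply: Lfun_sum => // i; exact: LfunZ.
rewrite rnorm2E; last by apply: LfunB => //; exact: Lfun_cst.
pose Q x := \sum_(0 <= i < n) \sum_(0 <= j < n) z i * z j * (b i x * b j x).
pose S x := \sum_(0 <= i < n) z i * b i x.
have hQ : Q \in Lfun mu 1.
  by apply: (Lfun_sum n q1) => i; apply: (Lfun_sum n q1) => j; exact: (LfunZ _ q1).
have hS : S \in Lfun mu 1 by apply: (Lfun_sum n q1) => i; exact: (LfunZ _ q1).
have hS2 : (fun x => 2 * a * S x) \in Lfun mu 1 by exact: (LfunZ _ q1).
have ca : cst (a ^+ 2) \in Lfun mu 1 by exact: Lfun_cst.
transitivity (\int[mu]_x (Q x - 2 * a * S x + cst (a ^+ 2) x))%R.
  apply: eq_Rintegral => x _ /=; rewrite -/(S x) sqrrB; congr (_ - _ + _).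
    rewrite expr2 /S /Q big_distrlr/=; apply: eq_bigr => i _; apply: eq_bigr => j _.
    by ring.
  by ring.
rewrite RintegralD//; last 2 first.
- exact/Lfun1_integrable/(LfunB q1 hQ hS2).
- exact/Lfun1_integrable.
rewrite RintegralB//; last 2 first.
- exact/Lfun1_integrable.
- exact/Lfun1_integrable.
rewrite Rintegral_cst// [X in fine X](@probability_setT _ _ _ mu) mulr1.
congr (_ - _ + _).
  rewrite Rintegral_sum; last by move=> i; apply: (Lfun_sum n q1) => j; exact: (LfunZ _ q1).
  apply: eq_bigr => i _; rewrite Rintegral_sum; last by move=> j; exact: (LfunZ _ q1).
  apply: eq_bigr => j _; rewrite RintegralZl//; exact/Lfun1_integrable.
rewrite RintegralZl//; last exact/Lfun1_integrable.
congr (_ * _); rewrite Rintegral_sum; last by move=> i; exact: (LfunZ _ q1).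
by apply: eq_bigr => i _; rewrite RintegralZl//; exact/Lfun1_integrable.
Qed.

(** With [S] the sum of the [|z i|], the error is at most [(S^2 + 2 |a| S) e], hence at most
    [(|a| + S)^2 e]. The estimate [|y| <= 1 + y^2] then replaces absolute values by polynomials,
    which stay within computable rational arithmetic. *)
Lemma rnorm2_affine_approx n (z : nat -> R) (a e : R) (gm : nat -> nat -> R) (m : nat -> R) :
  0 <= e ->
  (forall i j, `|\int[mu]_x (b i x * b j x) - gm i j| <= e) ->
  (forall i, `|\int[mu]_x b i x - m i| <= e) ->
  `|rnorm mu 2 ((fun x => \sum_(0 <= i < n) z i * b i x) \- cst a) ^+ 2 -
    (\sum_(0 <= i < n) \sum_(0 <= j < n) z i * z j * gm i j
     - 2 * a * \sum_(0 <= i < n) z i * m i + a ^+ 2)| <=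
  (1 + a ^+ 2 + \sum_(0 <= i < n) (1 + z i ^+ 2)) ^+ 2 * e.
Proof.
move=> e0 hg hm; rewrite rnorm2_affine.
set A := \sum_(0 <= i < n) \sum_(0 <= j < n) _ * \int[mu]_x _.
set B := \sum_(0 <= i < n) _ * \int[mu]_x _.
set A' := \sum_(0 <= i < n) \sum_(0 <= j < n) _ * gm _ _.
set B' := \sum_(0 <= i < n) _ * m _.
pose S := \sum_(0 <= i < n) `|z i|.
have S0 : 0 <= S by exact: sumr_ge0.
have le1 (y : R) : `|y| <= 1 + y ^+ 2.
  rewrite -[y ^+ 2]real_normK ?num_real//; move: (normr_ge0 y).
  by move: `|y| => u; nra.
have SQ : S <= \sum_(0 <= i < n) (1 + z i ^+ 2) by apply: ler_sum.
have hA : `|A - A'| <= S * S * e.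
  rewrite /A /A' -sumrB (le_trans (ler_norm_sum _ _ _))// /S big_distrl/= mulr_suml.
  apply: ler_sum => i _; rewrite -sumrB (le_trans (ler_norm_sum _ _ _))//.
  rewrite mulr_sumr mulr_suml; apply: ler_sum => j _.
  by rewrite -mulrBr !normrM ler_wpM2l ?mulr_ge0.
have hB : `|B - B'| <= S * e.
  rewrite /B /B' -sumrB (le_trans (ler_norm_sum _ _ _))// mulr_suml.
  by apply: ler_sum => i _; rewrite -mulrBr normrM ler_wpM2l.
rewrite (_ : A - _ + _ - _ = (A - A') - 2 * a * (B - B')); last by ring.
apply: le_trans (ler_normB _ _) _; rewrite !normrM normr_nat.
apply: le_trans (lerD hA (ler_wpM2l _ hB)) _; first by rewrite mulr_ge0.
apply: (@le_trans _ _ ((`|a| + S) ^+ 2 * e)).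
  rewrite -subr_ge0 [X in 0 <= X](_ : _ = `|a| ^+ 2 * e); last by ring.
  by rewrite mulr_ge0// sqr_ge0.
rewrite ler_wpM2r// lerXn2r ?nnegrE ?addr_ge0 ?sqr_ge0//.
  by apply: sumr_ge0 => i _; rewrite addr_ge0// sqr_ge0.
by apply: lerD.
Qed.

End Representations.

Section Certificate.
Variables (wm wk g F : baire).

Definition mean_approx (i q : nat) : rat := approx_real (part i wm) q.
Definition gram_approx (i j q : nat) : rat := approx_real (part j (part i g)) q.

(* The digits of [s] in base [B + 1] code a constant [cert_cst] and the
   coefficients of a combination [h] of [l] basis elements; [cert_comb] are the
   coefficients of [f - (h - T h)], with [f] and [T b_j] replaced by their
   approximations of precision [1 / (q + 1)]. *)
Definition cert_cst (B s : nat) : rat := rat_digit B s 0.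
Definition cert_coef (B s i : nat) : rat := rat_digit B s i.+1.

(** A common number of terms for all the combinations involved; the sum of the lengths is at least
    each of them. *)
Definition cert_size (l q : nat) : nat :=
  (l2_len F q + l + \sum_(0 <= j < l) l2_len (part j wk) q)%N.

Definition cert_comb (B s l q i : nat) : rat :=
  (i < l2_len F q)%N%:R * l2_coef F q i - (i < l)%N%:R * cert_coef B s i +
  \sum_(0 <= j < l) cert_coef B s j *
     ((i < l2_len (part j wk) q)%N%:R * l2_coef (part j wk) q i).

Definition cert_sqnorm (t B s l q : nat) : rat :=
  \sum_(0 <= i < cert_size l q) \sum_(0 <= j < cert_size l q)
     cert_comb B s l q i * cert_comb B s l q j * gram_approx i j t
  - 2%:R * cert_cst B s * (\sum_(0 <= i < cert_size l q) cert_comb B s l q i * mean_approx i t)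
  + cert_cst B s * cert_cst B s.

Definition cert_weight (B s l q : nat) : rat :=
  1%:R + cert_cst B s * cert_cst B s +
  \sum_(0 <= i < cert_size l q) (1%:R + cert_comb B s l q i * cert_comb B s l q i).

Definition cert_error (t B s l q : nat) : rat :=
  cert_weight B s l q * cert_weight B s l q / t.+1%:R.

Definition coef_weight (B s l : nat) : rat :=
  \sum_(0 <= j < l) (1%:R + cert_coef B s j * cert_coef B s j).

(** A bound on the norm of [h]. The Gram entry of [b j] is read with error at most 1, so adding 2
    gives at least [1 + |b j|^2], which exceeds [|b j|]. The precision is fixed so that the bound
    does not move with [t], and a large [t] finally passes it. *)
Definition coef_bound (B s l : nat) : rat :=
  \sum_(0 <= j < l) (1%:R + cert_coef B s j * cert_coef B s j) * (2%:R + gram_approx j j 0).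

(** [(K.*2.+1).+1] is [2 (K + 1)]. Half of the precision [1 / (K + 1)] covers the replacement of [f]
    and [T b_j] by approximations, the other half the norm of the resulting combination, tested
    through its square to avoid roots. *)
Definition certifies (K t B s l q : nat) : bool :=
  [&& (1%:R + coef_weight B s l) / q.+1%:R <= 1%:R / (K.*2.+1).+1%:R,
      cert_sqnorm t B s l q + cert_error t B s l q <=
        (1%:R / (K.*2.+1).+1%:R) * (1%:R / (K.*2.+1).+1%:R) &
      coef_bound B s l <= t%:R].

Definition certified (K t : nat) : bool :=
  has (fun B => has (fun s => has (fun l => has (fun q => certifies K t B s l q)
    (iota 0 t)) (iota 0 t)) (iota 0 t)) (iota 0 t).

Lemma certifiedP K t : reflect
  (exists B s l q, [/\ (B < t)%N, (s < t)%N, (l < t)%N, (q < t)%N & certifies K t B s l q])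
  (certified K t).
Proof.
apply: (iffP hasP) => [[B + /hasP[s + /hasP[l + /hasP[q +]]]]|].
  by rewrite !mem_iota /= !add0n => hB hs hl hq h; exists B, s, l, q.
move=> [B [s [l [q [hB hs hl hq h]]]]]; exists B; first by rewrite mem_iota.
apply/hasP; exists s; first by rewrite mem_iota.
apply/hasP; exists l; first by rewrite mem_iota.
by apply/hasP; exists q; first by rewrite mem_iota.
Qed.

End Certificate.

(** * Soundness and completeness of certificates *)

Section CertificateMeaning.
Context d (X : measurableType d) (R : realType) (mu : probability X R).
Variables (tau : X -> X) (b : nat -> X -> R) (f : X -> R) (wm wk g F : baire).
Hypotheses (mp : measure_preserving mu tau) (hb : L2_basis mu b).
Hypotheses (hf : f \in Lfun mu 2%:E).
Hypotheses (hwm : rep_measure mu b wm) (hg : rep_gram mu b g).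
Hypotheses (hwk : rep_koopman mu tau b wk) (hF : rep_L2 mu b f F).
Local Notation T := (koopman tau).

Let p2 : 1 <= 2 :> R. Proof. by rewrite ler1n. Qed.
Let hbi i : b i \in Lfun mu 2%:E. Proof. by case: hb. Qed.
Let hTb i : T (b i) \in Lfun mu 2%:E. Proof. exact: Lfun_koopman. Qed.

Section Fixed.
Variables (B s l q : nat).
Let n := l2_len F q.
Let N := cert_size wk F l q.
Let c := cert_coef B s.
Let z := cert_comb wk F B s l q.
Let h := lincomb b l c.
Let u := lincomb b n (l2_coef F q).
Let v j := lincomb b (l2_len (part j wk) q) (l2_coef (part j wk) q).
Let Z := lincomb b N z \- cst (ratr (cert_cst B s)).
Let a : R := ratr (cert_cst B s).

Let Z_Lfun : Z \in Lfun mu 2%:E.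
Proof. by apply: LfunB => //; [exact: Lfun_lincomb | exact: Lfun_cst]. Qed.

Let hh : h \in Lfun mu 2%:E. Proof. exact: Lfun_lincomb. Qed.

Lemma lincomb_widen m k (e : nat -> rat) x : (m <= k)%N ->
  lincomb b m e x = \sum_(0 <= i < k) ratr ((i < m)%N%:R * e i) * b i x.
Proof.
move=> mk; rewrite /lincomb (big_nat_widen _ _ _ _ _ mk) big_mkcond/=.
apply: eq_bigr => i _; case: (i < m)%N; first by rewrite mul1r.
by rewrite mul0r rmorph0 mul0r.
Qed.

(** The computed vector [Z] differs from the true residual only by the errors made on [f] and on the
    [T b_j]. Masking coefficients beyond the length of each combination allows a single sum over [N]
    terms. *)
Let Z_eq : f \- cst a \- (h \- T h) =
  (f \- u) \+ Z \+ (fun x => \sum_(0 <= j < l) ratr (c j) * (T (b j) \- v j) x).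
Proof.
apply/funext => x /=; rewrite (_ : Z x = lincomb b N z x - a)//.
have le_n : (n <= N)%N by rewrite /N /cert_size -addnA leq_addr.
have le_l : (l <= N)%N by rewrite /N /cert_size addnAC leq_addl.
have le_v j : (j < l)%N -> (l2_len (part j wk) q <= N)%N.
  move=> jl; rewrite /N /cert_size (big_rem j) ?mem_index_iota//=.
  by rewrite addnCA leq_addr.
have -> : lincomb b N z x = u x - h x + \sum_(0 <= j < l) ratr (c j) * v j x.
  rewrite /u /h (lincomb_widen _ _ le_n) (lincomb_widen _ _ le_l) -sumrB.
  have -> : \sum_(0 <= j < l) ratr (c j) * v j x =
      \sum_(0 <= j < l) \sum_(0 <= i < N) ratr (c j) *
        (ratr ((i < l2_len (part j wk) q)%N%:R * l2_coef (part j wk) q i) * b i x).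
    apply: eq_big_nat => j /andP[_ jl].
    by rewrite /v (lincomb_widen _ _ (le_v _ jl)) mulr_sumr.
  rewrite exchange_big/= -big_split/=; apply: eq_bigr => i _.
  rewrite /z /cert_comb rmorphD rmorphB/= mulrDl mulrBl; congr (_ + _).
  rewrite rmorph_sum/= mulr_suml; apply: eq_bigr => j _.
  by rewrite rmorphM/= mulrA.
have -> : \sum_(0 <= j < l) ratr (c j) * (T (b j) x - v j x) =
    T h x - \sum_(0 <= j < l) ratr (c j) * v j x.
  by rewrite {1}/koopman /h /lincomb -sumrB; apply: eq_bigr => j _; rewrite mulrBr.
by ring.
Qed.

Let abs_le_sqr (y : R) : `|y| <= 1 + y * y.
Proof.
have -> : y * y = `|y| ^+ 2 by rewrite real_normK ?num_real.
by move: (normr_ge0 y); move: `|y| => w; nra.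
Qed.

Lemma error_bound :
  rnorm mu 2 ((f \- u) \+ (fun x => \sum_(0 <= j < l) ratr (c j) * (T (b j) \- v j) x))
   <= ratr ((1%:R + coef_weight B s l) / q.+1%:R).
Proof.
have hu : f \- u \in Lfun mu 2%:E by apply: LfunB => //; exact: Lfun_lincomb.
have hv j : T (b j) \- v j \in Lfun mu 2%:E by apply: LfunB => //; exact: Lfun_lincomb.
have hcv j : (fun x => ratr (c j) * (T (b j) \- v j) x) \in Lfun mu 2%:E by exact: LfunZ.
apply: le_trans (rnormD p2 hu (Lfun_sum _ p2 hcv)) _.
rewrite rmorphM/= ratr_inv_nat rmorphD/= ratr_nat mulrDl mul1r; apply: lerD.
  exact: l2_approxP.
apply: le_trans (rnorm_sum _ p2 hcv) _.
rewrite /coef_weight rmorph_sum/= mulr_suml; apply: ler_sum => j _.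
rewrite (rnormZ _ p2 (hv j)); apply: ler_pM; rewrite ?rnorm_ge0//.
  by rewrite rmorphD rmorphM/= ratr_nat abs_le_sqr.
exact: (l2_approxP hbi q (hTb j) (hwk j)).
Qed.

Let E_Lfun : (f \- u) \+ (fun x => \sum_(0 <= j < l) ratr (c j) * (T (b j) \- v j) x)
  \in Lfun mu 2%:E.
Proof.
apply: LfunD => //; first by apply: LfunB => //; exact: Lfun_lincomb.
by apply: Lfun_sum => // j; apply: LfunZ => //; apply: LfunB => //; exact: Lfun_lincomb.
Qed.

Lemma residual_le : rnorm mu 2 (f \- cst a \- (h \- T h)) <=
  ratr ((1%:R + coef_weight B s l) / q.+1%:R) + rnorm mu 2 Z.
Proof.
rewrite Z_eq.
rewrite (_ : _ \+ _ = ((f \- u) \+ (fun x => \sum_(0 <= j < l) ratr (c j) * (T (b j) \- v j) x)) \+ Z); last first.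
  by apply/funext => x /=; ring.
by apply: le_trans (rnormD p2 E_Lfun Z_Lfun) _; rewrite lerD2r error_bound.
Qed.

(** [residual_le] passes from [Z] to the residual, for soundness; this converse shows that a small
    residual is detected, for completeness. *)
Lemma comb_le : rnorm mu 2 Z <=
  ratr ((1%:R + coef_weight B s l) / q.+1%:R) + rnorm mu 2 (f \- cst a \- (h \- T h)).
Proof.
have hr : f \- cst a \- (h \- T h) \in Lfun mu 2%:E.
  apply: LfunB => //; first by apply: LfunB => //; exact: Lfun_cst.
  by apply: LfunB => //; exact: Lfun_koopman.
rewrite (_ : Z = (f \- cst a \- (h \- T h)) \-
    ((f \- u) \+ (fun x => \sum_(0 <= j < l) ratr (c j) * (T (b j) \- v j) x))); last first.
  by rewrite Z_eq; apply/funext => x /=; ring.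
by apply: le_trans (rnormB p2 hr E_Lfun) _; rewrite addrC lerD2r error_bound.
Qed.

Lemma sqnorm_approx t : `|rnorm mu 2 Z ^+ 2 - ratr (cert_sqnorm wm wk g F t B s l q)| <=
  ratr (cert_error wk F t B s l q).
Proof.
have t0 : 0 <= t.+1%:R^-1 :> R by rewrite invr_ge0.
have := @rnorm2_affine_approx _ _ _ mu b hbi N (fun i => ratr (z i)) a t.+1%:R^-1
  (fun i j => ratr (gram_approx g i j t)) (fun i => ratr (mean_approx wm i t)) t0
  (fun i j => approx_realP t (hg i j)) (fun i => approx_realP t (hwm i)).
rewrite -/(lincomb b N z) => key.
rewrite (_ : ratr (cert_sqnorm wm wk g F t B s l q) =
  \sum_(0 <= i < N) \sum_(0 <= j < N) ratr (z i) * ratr (z j) * ratr (gram_approx g i j t) -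
  2 * a * (\sum_(0 <= i < N) ratr (z i) * ratr (mean_approx wm i t)) + a ^+ 2).
  apply: le_trans key _; rewrite /cert_error /cert_weight /a /z /N.
  move: (cert_cst B s) (cert_comb wk F B s l q) (cert_size wk F l q) => a0 z0 N0.
  rewrite !rmorphM/= ratr_inv_nat -expr2 !rmorphD/= rmorphM/= ratr_nat expr2 rmorph_sum/=.
  rewrite (eq_bigr (fun i => ratr (1%:R + z0 i * z0 i)))// => i _.
  by rewrite rmorphD rmorphM/= ratr_nat expr2.
rewrite /cert_sqnorm /a /z /N.
move: (cert_cst B s) (cert_comb wk F B s l q) (cert_size wk F l q) => a0 z0 N0.
rewrite rmorphD rmorphB !rmorphM/= ratr_nat expr2 !rmorph_sum/=.
congr (_ - _ * _ + _); apply: eq_bigr => i _; last by rewrite rmorphM.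
by rewrite rmorph_sum; apply: eq_bigr => j _; rewrite !rmorphM.
Qed.

Lemma coef_bound_le : rnorm mu 2 h <= ratr (coef_bound g B s l).
Proof.
have hc j : (fun x => ratr (c j) * b j x) \in Lfun mu 2%:E by exact: LfunZ.
apply: le_trans (rnorm_sum _ p2 hc) _.
rewrite /coef_bound rmorph_sum/=; apply: ler_sum => j _.
rewrite (rnormZ _ p2 (hbi j)) [leRHS]rmorphM/=; apply: ler_pM; rewrite ?rnorm_ge0//.
  by rewrite rmorphD rmorphM/= ratr_nat abs_le_sqr.
have := approx_realP 0 (hg j j); rewrite -/(gram_approx g j j 0) invr1 ler_distl.
have -> : \int[mu]_x (b j x * b j x) = rnorm mu 2 (b j) ^+ 2.
  by rewrite rnorm2E//; apply: eq_Rintegral => x _; rewrite expr2.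
move=> /andP[_]; rewrite rmorphD/= ratr_nat.
by move: (rnorm _ _ _) (rnorm_ge0 mu 2 (b j)) (ratr _) => y y0 w; nra.
Qed.
End Fixed.

Lemma certified_sound K t : certified wm wk g F K t ->
  exists (c : R) h, [/\ h \in Lfun mu 2%:E, rnorm mu 2 h <= t%:R &
    rnorm mu 2 (f \- cst c \- (h \- T h)) <= K.+1%:R^-1].
Proof.
move=> /certifiedP[B [s [l [q [_ _ _ _ /and3P[h1 h2 h3]]]]]].
exists (ratr (cert_cst B s)), (lincomb b l (cert_coef B s)); split.
- exact: Lfun_lincomb.
- by apply: le_trans (coef_bound_le _ _ _) _; rewrite -(ratr_nat R) ler_rat.
have K2 : K.+1%:R^-1 = (K.*2.+1).+1%:R^-1 + (K.*2.+1).+1%:R^-1 :> R.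
  have -> : (K.*2.+1).+1 = (2 * K.+1)%N by rewrite mul2n doubleS.
  by rewrite -mulr2n -[RHS]mulr_natl natrM invfM mulVKf.
apply: le_trans (residual_le B s l q) _; rewrite K2; apply: lerD.
  by move: h1; rewrite div1r -(ler_rat R) ratr_inv_nat.
rewrite -(@ler_pXn2r _ 2)// ?nnegrE ?rnorm_ge0 ?invr_ge0//.
have := sqnorm_approx B s l q t; rewrite ler_distl => /andP[_] /le_trans; apply.
by move: h2; rewrite div1r -(ler_rat R) rmorphD [X in _ <= X -> _]rmorphM/= ratr_inv_nat -expr2.
Qed.

(** Four quarters of [e]: one for the real pair, one for rounding its constant to a rational, and
    two for replacing its [h0] by a rational combination at distance below [e / 4], as [D - T D] has
    norm at most [2 |D|]. *)
Lemma rat_certificate (e : R) : ergodic mu tau -> 0 < e ->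
  exists B s l, rnorm mu 2 (f \- cst (ratr (cert_cst B s)) \-
    (lincomb b l (cert_coef B s) \- T (lincomb b l (cert_coef B s)))) < e.
Proof.
move=> erg e0; have e4 : 0 < e / 4 by rewrite divr_gt0.
have [a0 [h0 [hh0 hr]]] := coboundary_approx mp erg hf e4.
case: hb => _ /(_ h0 hh0 _ e4) [l [c hc]].
have hl : lincomb b l c \in Lfun mu 2%:E by exact: Lfun_lincomb.
have {}hc : rnorm mu 2 (lincomb b l c \- h0) < e / 4.
  by rewrite -lte_fin -rnormE//; exact: LfunB.
have [a /andP[a1 a2]] : exists a : rat, a0 - e / 4 < ratr a < a0 + e / 4.
  have /rat_in_itvoo[a] : a0 - e / 4 < a0 + e / 4 by lra.
  by rewrite in_itv/=; exists a.
have [B [s Bs]] := rat_digits_surj (fun i => if i is i'.+1 then c i' else a) l.+1.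
exists B, s, l.
have -> : cert_cst B s = a by rewrite /cert_cst Bs.
have -> : lincomb b l (cert_coef B s) = lincomb b l c.
  apply/funext => x; apply: eq_big_nat => i /andP[_ il].
  by rewrite /cert_coef Bs.
set h := lincomb b l c in hl hc *.
pose D := h \- h0.
have hD : D \in Lfun mu 2%:E by exact: LfunB.
have hTD := Lfun_koopman mp hD.
have hr0 : f \- cst a0 \- (h0 \- T h0) \in Lfun mu 2%:E.
  apply: LfunB => //; first by apply: LfunB => //; exact: Lfun_cst.
  by apply: LfunB => //; exact: Lfun_koopman.
have ha : cst (a0 - ratr a) \in Lfun mu 2%:E by exact: Lfun_cst.
have -> : f \- cst (ratr a) \- (h \- T h) =
    (f \- cst a0 \- (h0 \- T h0)) \+ cst (a0 - ratr a) \- (D \- T D).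
  apply/funext => x; rewrite /D /koopman /=; ring.
apply: le_lt_trans (rnormB p2 (LfunD p2 hr0 ha) (LfunB p2 hD hTD)) _.
apply: le_lt_trans (lerD (rnormD p2 hr0 ha) (rnormB p2 hD hTD)) _.
rewrite rnorm_cst// rnorm_koopman//.
have : `|a0 - ratr a| < e / 4 by rewrite ltr_distl; lra.
by move: hr hc; rewrite -/D; lra.
Qed.

Lemma inv_nat_lt (x e : R) : 0 < e -> exists n : nat, forall m, (n <= m)%N -> x / m.+1%:R <= e.
Proof.
move=> e0; exists (Num.trunc (x / e)) => m nm.
rewrite ler_pdivrMr// -ler_pdivrMl// mulrC.
by rewrite (le_trans (ltW (truncnS_gt _)))// ler_nat.
Qed.

(** The order of choices matters. With [e = 1 / (2 (K + 1))], first a code with residual below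
    [e / 4], then [q] with replacement error at most [e / 4], so that [Z <= e / 2]. The weight is
    now fixed, and [t] is taken large enough to exceed the code and the bound on [h], and to make
    the error term at most [e^2 / 4]. This term counts twice, once in the test and once inside the
    approximate square: [e^2 / 4 + 2 e^2 / 4 <= e^2]. *)
Lemma certified_complete K : ergodic mu tau -> exists t, certified wm wk g F K t.
Proof.
move=> erg; pose e : R := (K.*2.+1).+1%:R^-1.
have e0 : 0 < e by rewrite invr_gt0.
have e4 : 0 < e / 4 by rewrite divr_gt0.
have [B [s [l hr]]] := rat_certificate erg e4.
have [q /(_ q (leqnn q)) hq] := inv_nat_lt (ratr (1%:R + coef_weight B s l)) e4.
have {}hq : ratr ((1%:R + coef_weight B s l) / q.+1%:R) <= e / 4.
  by rewrite rmorphM/= ratr_inv_nat.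
have hZ := le_trans (comb_le B s l q) (lerD hq (ltW hr)).
set Z := rnorm mu 2 _ in hZ.
have Z0 : 0 <= Z by exact: rnorm_ge0.
have e8 : 0 < e * e / 4 by rewrite divr_gt0// mulr_gt0.
have [t1 ht1] := inv_nat_lt (ratr (cert_weight wk F B s l q * cert_weight wk F B s l q)) e8.
have [t2 ht2] : exists t2 : nat, coef_bound g B s l <= t2%:R.
  by exists (Num.trunc (coef_bound g B s l)).+1; rewrite ltW// truncnS_gt.
pose t := (maxn t1 t2 + (maxn B s + maxn l q).+1)%N.
exists t; apply/certifiedP; exists B, s, l, q.
have ltt i : (i <= maxn B s + maxn l q)%N -> (i < t)%N.
  by move=> hi; rewrite /t addnS ltnS (leq_trans hi)// leq_addl.
split; try apply: ltt.
- by rewrite (leq_trans (leq_maxl B s))// leq_addr.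
- by rewrite (leq_trans (leq_maxr B s))// leq_addr.
- by rewrite (leq_trans (leq_maxl l q))// leq_addl.
- by rewrite (leq_trans (leq_maxr l q))// leq_addl.
apply/and3P; split.
- rewrite -(ler_rat R) div1r ratr_inv_nat (le_trans hq)// -/e.
  by move: e0; lra.
- have /ht1 herr : (t1 <= t)%N by rewrite /t (leq_trans (leq_maxl t1 t2))// leq_addr.
  have {}herr : ratr (cert_error wk F t B s l q) <= e * e / 4.
    by rewrite /cert_error rmorphM/= ratr_inv_nat.
  rewrite -(ler_rat R) rmorphD div1r [leRHS]rmorphM/= ratr_inv_nat -/e.
  have := sqnorm_approx B s l q t; rewrite ler_distlC => /andP[_] hn.
  have Z2 : Z ^+ 2 <= (e / 2) ^+ 2.
    rewrite lerXn2r ?nnegrE//; first by move: e0; lra.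
    by move: hZ; rewrite -/Z; lra.
  have E : (e / 2) ^+ 2 = e * e / 4 by field.
  by move: hn Z2 herr e8; rewrite -/Z E; lra.
- by rewrite (le_trans ht2)// ler_nat /t (leq_trans (leq_maxr t1 t2))// leq_addr.
Qed.

End CertificateMeaning.

(** * Searching for certificates *)

Section CertificateSearch.
Variables (env : Type) (orc gram : env -> baire) (F : env -> nat -> baire) (H : prog).
Implicit Types C : ctx env.
Local Notation computable := (computable orc).
Local Notation computables := (computables orc).
Local Notation computableQ := (computableQ orc).

(** Access is stated for one length of queries at a time, because [gram] is available only through a
    program that is correct on inputs of a fixed length. *)
Definition queryable n C (v : C -> baire) : Prop :=
  forall ts, size ts = n -> computables ts -> computable (fun c => v c [seq t c | t <- ts]).

Hypothesis gramP : forall e xs, size xs = 5 -> eval (orc e) H xs (gram e xs).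
Hypothesis queryableF : forall n C (j : C -> nat), computable j ->
  queryable n (fun c => F (ctx_env c) (j c)).

Lemma queryable_orc n C : queryable n (fun c : C => orc (ctx_env c)).
Proof. by move=> ts _; exact: computable_orc. Qed.

(** Five arguments: the indices [i] and [j], the choice between values and rate, and then either
    component and position of a value or the two parts of a precision. *)
Lemma queryable_gram C : queryable 5 (fun c : C => gram (ctx_env c)).
Proof.
move=> ts sts; apply: (@computable_comp _ _ _ H gram).
by move=> e xs; rewrite sts; exact: gramP.
Qed.

Lemma queryable_part n C (v : C -> baire) (i : C -> nat) : computable i ->
  queryable n.+1 v -> queryable n (fun c => part (i c) (v c)).
Proof. by move=> hi hv ts sts hts; apply: (hv (i :: ts)) => //=; rewrite sts. Qed.

Lemma queryable_qval n C (v : C -> baire) (ts : seq (C -> nat)) :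
  queryable n.+1 v -> size ts = n -> computables ts ->
  computableQ (fun c => qval (v c) [seq t c | t <- ts]).
Proof.
move=> hv sts hts.
have h k : computable (fun c => part k (v c) [seq t c | t <- ts]).
  exact: (queryable_part (computable_cst orc C k) hv).
exact: computableQ_qval.
Qed.

Lemma computableQ_approx_real C (v : C -> baire) (q : C -> nat) :
  queryable 3 v -> computable q -> computableQ (fun c => approx_real (v c) (q c)).
Proof.
move=> hv hq.
have hi : computable (fun c => part 1 (v c) [:: 0%N; q c]).
  apply: (queryable_part (computable_cst orc C 1) hv (ts := [:: fun=> 0%N; q])) => //.
  by split; first exact: computable_cst.
have := queryable_qval (queryable_part (computable_cst orc C 0) hv) (ts := [:: _]) erefl.
by move=> /(_ _ (conj hi I)).
Qed.

Lemma computable_l2_index C (v : C -> baire) (q : C -> nat) :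
  queryable 3 v -> computable q -> computable (fun c => l2_index (v c) (q c)).
Proof.
move=> hv hq.
apply: (queryable_part (computable_cst orc C 2) hv (ts := [:: fun=> 0%N; q])) => //.
by split; first exact: computable_cst.
Qed.

Lemma computable_l2_len C (v : C -> baire) (q : C -> nat) :
  (forall n, queryable n v) -> computable q -> computable (fun c => l2_len (v c) (q c)).
Proof.
move=> hv hq; have hi := computable_l2_index (hv 3%N) hq.
by apply: (queryable_part (computable_cst orc C 0) (hv 2%N) (ts := [:: _])) => //; split.
Qed.

Lemma computableQ_l2_coef C (v : C -> baire) (q i : C -> nat) :
  (forall n, queryable n v) -> computable q -> computable i ->
  computableQ (fun c => l2_coef (v c) (q c) (i c)).
Proof.
move=> hv hq hi; have hx := computable_l2_index (hv 3%N) hq.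
have := queryable_qval (queryable_part (computable_cst orc C 1) (hv 4%N)) (ts := [:: _; i]) erefl.
by move=> /(_ _ (conj hx (conj hi I))).
Qed.

Lemma queryable_koopman n C (j : C -> nat) : computable j ->
  queryable n (fun c => part (j c) (part 1 (orc (ctx_env c)))).
Proof.
move=> hj; apply: queryable_part => //.
apply: queryable_part; [exact: computable_cst | exact: queryable_orc].
Qed.

Lemma computable_ltn C (t u : C -> nat) :
  computable t -> computable u -> computable (fun c => (t c < u c)%N : nat).
Proof. by move=> ht hu; apply: computable_leq => //; exact: computable_succ. Qed.

Lemma computableQ_cst C (n : nat) : computableQ (fun _ : C => n%:R).
Proof. exact/computableQ_nat/computable_cst. Qed.

Lemma computableQ_mean_approx C (i q : C -> nat) :
  computable i -> computable q ->
  computableQ (fun c => mean_approx (part 0 (orc (ctx_env c))) (i c) (q c)).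
Proof.
move=> hi hq; apply: computableQ_approx_real => //.
apply: queryable_part => //; apply: queryable_part; first exact: computable_cst.
exact: queryable_orc.
Qed.

Lemma computableQ_gram_approx C (i j q : C -> nat) :
  computable i -> computable j -> computable q ->
  computableQ (fun c => gram_approx (gram (ctx_env c)) (i c) (j c) (q c)).
Proof.
move=> hi hj hq; apply: computableQ_approx_real => //.
apply: queryable_part => //; apply: queryable_part => //; exact: queryable_gram.
Qed.

Lemma computableQ_cert_cst C (B s : C -> nat) : computable B -> computable s ->
  computableQ (fun c => cert_cst (B c) (s c)).
Proof. by move=> hB hs; apply: computableQ_rat_digit => //; exact: computable_cst. Qed.

Lemma computableQ_cert_coef C (B s i : C -> nat) :
  computable B -> computable s -> computable i ->
  computableQ (fun c => cert_coef (B c) (s c) (i c)).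
Proof. by move=> hB hs hi; apply: computableQ_rat_digit => //; exact: computable_succ. Qed.

Section CoefficientSums.
Variables (C : ctx env) (B s l q j : C -> nat).
Hypotheses (hB : computable B) (hs : computable s) (hl : computable l).
Hypotheses (hq : computable q) (hj : computable j).

Lemma computable_cert_size :
  computable (fun c => cert_size (part 1 (orc (ctx_env c))) (F (ctx_env c) (j c)) (l c) (q c)).
Proof.
apply: computable_add; first apply: computable_add => //.
  by apply: computable_l2_len => // n; exact: queryableF.
apply: computable_sum => //.
apply: (@computable_l2_len (ctx_ext C)); last exact: (computable_weak hq).
by move=> n; apply: (@queryable_koopman n (ctx_ext C)); exact: computable_var.
Qed.

Lemma computableQ_coef_weight : computableQ (fun c => coef_weight (B c) (s c) (l c)).
Proof.
apply: computableQ_sum => //.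
have hc : computableQ (fun c : ctx_ext C => cert_coef (B c.1) (s c.1) c.2).
  apply: (@computableQ_cert_coef (ctx_ext C)); [exact: (computable_weak hB) |
    exact: (computable_weak hs) | exact: computable_var].
apply: (@computableQ_add _ _ (ctx_ext C)); first exact: (computableQ_cst (ctx_ext C)).
exact: computableQ_mul.
Qed.

Lemma computableQ_coef_bound :
  computableQ (fun c => coef_bound (gram (ctx_env c)) (B c) (s c) (l c)).
Proof.
apply: computableQ_sum => //.
have hc : computableQ (fun c : ctx_ext C => cert_coef (B c.1) (s c.1) c.2).
  apply: (@computableQ_cert_coef (ctx_ext C)); [exact: (computable_weak hB) |
    exact: (computable_weak hs) | exact: computable_var].
apply: (@computableQ_mul _ _ (ctx_ext C)); apply: (@computableQ_add _ _ (ctx_ext C));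
  try exact: (computableQ_cst (ctx_ext C)); first exact: computableQ_mul.
apply: (@computableQ_gram_approx (ctx_ext C)); try exact: computable_var.
exact: (computable_cst orc (ctx_ext C)).
Qed.

End CoefficientSums.

Lemma computableQ_cert_comb C (B s l q j i : C -> nat) :
  computable B -> computable s -> computable l -> computable q -> computable j ->
  computable i ->
  computableQ (fun c => cert_comb (part 1 (orc (ctx_env c)))
    (F (ctx_env c) (j c)) (B c) (s c) (l c) (q c) (i c)).
Proof.
move=> hB hs hl hq hj hi.
have hF n : queryable n (fun c => F (ctx_env c) (j c)) by exact: queryableF.
apply: computableQ_add; first apply: computableQ_sub.
- apply: computableQ_mul; last exact: computableQ_l2_coef.
  apply: computableQ_nat; apply: computable_ltn => //; exact: computable_l2_len.
- apply: computableQ_mul; last exact: computableQ_cert_coef.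
  by apply: computableQ_nat; exact: computable_ltn.
apply: computableQ_sum => //.
have hk n : queryable n (fun c : ctx_ext C => part c.2 (part 1 (orc (ctx_env c)))).
  by apply: queryable_koopman; exact: computable_var.
have hq' := computable_weak hq; have hi' := computable_weak hi.
apply: (@computableQ_mul _ _ (ctx_ext C)).
  apply: (@computableQ_cert_coef (ctx_ext C)); [exact: (computable_weak hB) |
    exact: (computable_weak hs) | exact: computable_var].
apply: (@computableQ_mul _ _ (ctx_ext C)); last exact: (computableQ_l2_coef hk hq' hi').
apply: (@computableQ_nat _ _ (ctx_ext C)); apply: (@computable_ltn (ctx_ext C)) => //.
exact: (computable_l2_len hk hq').
Qed.

Section Check.
Variables (C : ctx env) (K t B s l q j : C -> nat).
Hypotheses (hK : computable K) (ht : computable t) (hB : computable B).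
Hypotheses (hs : computable s) (hl : computable l) (hq : computable q).
Hypothesis (hj : computable j).

Let hN := computable_cert_size hl hq hj.
Let hz : computableQ (fun c : ctx_ext C => cert_comb (part 1 (orc (ctx_env c)))
    (F (ctx_env c) (j c.1)) (B c.1) (s c.1) (l c.1) (q c.1) c.2).
Proof.
by apply: (@computableQ_cert_comb (ctx_ext C)); try exact: computable_var;
  exact: computable_weak.
Qed.

Lemma computableQ_cert_weight : computableQ (fun c =>
  cert_weight (part 1 (orc (ctx_env c))) (F (ctx_env c) (j c)) (B c) (s c) (l c) (q c)).
Proof.
have ha := computableQ_cert_cst hB hs.
apply: computableQ_add.
  by apply: computableQ_add; [exact: computableQ_cst | exact: computableQ_mul].
apply: computableQ_sum => //.
apply: (@computableQ_add _ _ (ctx_ext C)); first exact: (computableQ_cst (ctx_ext C)).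
exact: (computableQ_mul hz hz).
Qed.

Lemma computableQ_cert_error : computableQ (fun c =>
  cert_error (part 1 (orc (ctx_env c))) (F (ctx_env c) (j c)) (t c) (B c) (s c) (l c) (q c)).
Proof.
have hw := computableQ_cert_weight.
by apply: computableQ_divS => //; exact: computableQ_mul.
Qed.

Lemma computableQ_cert_sqnorm : computableQ (fun c =>
  cert_sqnorm (part 0 (orc (ctx_env c))) (part 1 (orc (ctx_env c))) (gram (ctx_env c))
    (F (ctx_env c) (j c)) (t c) (B c) (s c) (l c) (q c)).
Proof.
have ha := computableQ_cert_cst hB hs.
have ht' := computable_weak ht.
apply: computableQ_add; last exact: computableQ_mul.
apply: computableQ_sub; last first.
  apply: computableQ_mul; first by apply: computableQ_mul => //; exact: computableQ_cst.
  apply: computableQ_sum => //; apply: (computableQ_mul hz).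
  by apply: (@computableQ_mean_approx (ctx_ext C)) => //; exact: computable_var.
apply: computableQ_sum => //.
apply: (@computableQ_sum _ _ (ctx_ext C)); first exact: computable_weak hN.
have v1 := computable_var orc (ctx_ext C).
have v2 := computable_weak (computable_var orc C).
have hz2 : computableQ (fun c : ctx_ext (ctx_ext C) => cert_comb (part 1 (orc (ctx_env c)))
    (F (ctx_env c) (j c.1.1)) (B c.1.1) (s c.1.1) (l c.1.1) (q c.1.1) c.2).
  have w2 u : computable u -> computable (fun c : ctx_ext (ctx_ext C) => u c.1.1).
    by move=> hu; exact: (@computable_weak _ _ (ctx_ext C) _ (computable_weak hu)).
  by apply: (@computableQ_cert_comb (ctx_ext (ctx_ext C))) => //; exact: w2.
apply: (@computableQ_mul _ _ (ctx_ext (ctx_ext C))).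
  apply: (@computableQ_mul _ _ (ctx_ext (ctx_ext C))) => //.
  exact: (computableQ_weak hz).
apply: (@computableQ_gram_approx (ctx_ext (ctx_ext C))) => //.
exact: (computable_weak ht').
Qed.

Lemma computable_certifies : computable (fun c =>
  certifies (part 0 (orc (ctx_env c))) (part 1 (orc (ctx_env c))) (gram (ctx_env c))
    (F (ctx_env c) (j c)) (K c) (t c) (B c) (s c) (l c) (q c) : nat).
Proof.
have hd : computableQ (fun c => 1%:R / ((K c).*2.+1).+1%:R).
  apply: computableQ_divS; first exact: computableQ_cst.
  apply: computable_succ; apply: (@computable_ext _ _ _ (fun c => K c + K c)%N).
    by move=> c; rewrite addnn.
  exact: computable_add.
apply: computable_and; last apply: computable_and.
- apply: computableQ_le => //; apply: computableQ_divS => //.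
  by apply: computableQ_add; [exact: computableQ_cst | exact: computableQ_coef_weight].
- apply: computableQ_le; last exact: computableQ_mul.
  by apply: computableQ_add; [exact: computableQ_cert_sqnorm | exact: computableQ_cert_error].
- by apply: computableQ_le; [exact: computableQ_coef_bound | exact: computableQ_nat].
Qed.

End Check.

Lemma computable_certified C (K t j : C -> nat) :
  computable K -> computable t -> computable j -> computable (fun c =>
  certified (part 0 (orc (ctx_env c))) (part 1 (orc (ctx_env c))) (gram (ctx_env c))
    (F (ctx_env c) (j c)) (K c) (t c) : nat).
Proof.
move=> hK ht hj.
pose C1 := ctx_ext C; pose C2 := ctx_ext C1; pose C3 := ctx_ext C2; pose C4 := ctx_ext C3.
have weak4 u : computable u -> computable (fun c : C4 => u c.1.1.1.1).
  move=> hu; exact: (@computable_weak _ _ C3 _ (@computable_weak _ _ C2 _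
    (@computable_weak _ _ C1 _ (computable_weak hu)))).
apply: computable_exists => //.
apply: (@computable_exists _ _ C1); first exact: computable_weak ht.
apply: (@computable_exists _ _ C2); first exact: (@computable_weak _ _ C1 _ (computable_weak ht)).
apply: (@computable_exists _ _ C3).
  exact: (@computable_weak _ _ C2 _ (@computable_weak _ _ C1 _ (computable_weak ht))).
apply: (@computable_certifies C4); try exact: weak4.
- exact: (@computable_weak _ _ C3 _ (@computable_weak _ _ C2 _
    (@computable_weak _ _ C1 _ (computable_var orc C)))).
- exact: (@computable_weak _ _ C3 _ (@computable_weak _ _ C2 _ (computable_var orc C1))).
- exact: (@computable_weak _ _ C3 _ (computable_var orc C2)).
- exact: (computable_var orc C3).
Qed.

Lemma computable_certificate C (K j : C -> nat) :
  (forall e K j, exists t,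
    certified (part 0 (orc e)) (part 1 (orc e)) (gram e) (F e j) K t) ->
  computable K -> computable j ->
  exists2 N : C -> nat, computable N & forall c,
    certified (part 0 (orc (ctx_env c))) (part 1 (orc (ctx_env c))) (gram (ctx_env c))
      (F (ctx_env c) (j c)) (K c) (N c).
Proof.
move=> ex hK hj; apply: (@computable_search _ _ C
  (fun c t => certified _ _ (gram (ctx_env c)) _ (K c) t)); last by move=> c; exact: ex.
apply: (@computable_certified (ctx_ext C) (fun c => K c.1) snd (fun c => j c.1)).
- exact: computable_weak.
- exact: computable_var.
- exact: computable_weak.
Qed.

End CertificateSearch.

(** * Assembling the programs *)

Section Programs.
Variables (env : Type) (orc : env -> baire).

(** Inputs are cut or padded with zeros to length [n]. This agrees with reading missing arguments as
    0 and makes the final programs total on inputs of every length. *)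
Program Definition ctx_input (n : nat) : ctx env :=
  @Ctx env (env * seq nat) fst (fun c => mkseq (nth 0%N c.2) n) n _.
Next Obligation. by move=> n c; rewrite size_mkseq. Qed.

Lemma computable_input n i : (i < n)%N ->
  computable orc (fun c : ctx_input n => nth 0%N c.2 i).
Proof. by move=> lin; exists (Proj i) => c /=; rewrite nth_mkseq. Qed.

Lemma computable_input_eval n (t : ctx_input n -> nat) : computable orc t ->
  exists P, forall e xs, eval (orc e) P xs (t (e, xs)).
Proof.
move=> [P hP]; exists (Comp P [seq Proj i | i <- iota 0 n]) => e xs.
exists (mkseq (nth 0%N xs) n); last exact: hP (e, xs).
by rewrite /mkseq; elim: (iota 0 n) => //= i s IH.
Qed.

End Programs.

(** A rate is a function of the rational, whereas a program receives a fraction, and a search may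
    answer differently on two fractions of the same value. Searching only at the integer part of the
    inverse makes the answer depend on the value alone. *)
Definition inv_floor (p q : nat) : nat := (q.+1 %/ p.+1)%N.

Lemma inv_floorE p q : Num.trunc (posq p q)^-1 = inv_floor p q.
Proof.
have p0 : 0 < p.+1%:R :> rat by [].
apply: truncn_def; rewrite /posq /inv_floor invf_div ler_pdivlMr// ltr_pdivrMr//.
by rewrite -!natrM ler_nat ltr_nat leq_trunc_div ltn_ceil.
Qed.

(* If the precision is [e > 1 / (k + 1)] with [k = inv_floor p q], the error of
   [f - c - (h - T h)] may be [1 / (4 (k + 1))]; [t] bounds the norm of [h] at
   the precision passed to it. *)
Definition norm_rate_value (t : nat -> nat) (k : nat) : nat :=
  (8 * (t (8 * k.+1).-1).+1 * k.+1)%N.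

Definition pointwise_rate_value (t : nat -> nat) (k1 k2 : nat) : nat :=
  (384 * ((t (16 * k1.+1 * k2.+1).-1).+1 ^ 2 * k1.+1 ^ 2) * k2.+1)%N.

Definition norm_rate_oracle (t : nat -> nat) : baire := fun xs =>
  norm_rate_value t (inv_floor (nth 0%N xs 0) (nth 0%N xs 1)).

Definition pointwise_rate_oracle (t : nat -> nat) : baire := fun xs =>
  pointwise_rate_value t (inv_floor (nth 0%N xs 0) (nth 0%N xs 1))
    (inv_floor (nth 0%N xs 2) (nth 0%N xs 3)).

(* The data of [f] is either a representation of [f] itself or, for an
   approximation in the L1 norm, a sequence of representations with a rate. *)
Definition approximant (via_L1 : bool) (w : baire) (j : nat) : baire :=
  if via_L1 then part j (part 0 (part 2 w)) else part 2 w.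

Definition approximant_index (via_L1 : bool) (w : baire) (q : nat) : nat :=
  if via_L1 then part 1 (part 2 w) [:: 0%N; q] else 0%N.

Lemma search_programs (via_L1 : bool) (H : prog) : exists Pn Pp : prog,
  forall o gr : baire,
  (forall xs, size xs = 5 -> eval o H xs (gr xs)) ->
  (forall K j, exists t,
     certified (part 0 o) (part 1 o) gr (approximant via_L1 o j) K t) ->
  exists t : nat -> nat,
  [/\ forall K, certified (part 0 o) (part 1 o) gr
        (approximant via_L1 o (approximant_index via_L1 o K)) K (t K),
      forall xs, eval o Pn xs (norm_rate_oracle t xs) &
      forall xs, eval o Pp xs (pointwise_rate_oracle t xs)].
Proof.
(* [computable] quantifies over every environment. Both promises, correctness of [H] and termination
   of the search, are therefore put into the type of environments, and the programs are obtained
   before any oracle is given. *)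
pose env := {og : baire * baire | (forall xs, size xs = 5 -> eval og.1 H xs (og.2 xs)) /\
  (forall K j, exists t,
     certified (part 0 og.1) (part 1 og.1) og.2 (approximant via_L1 og.1 j) K t)}.
pose orc (e : env) := (sval e).1; pose gram (e : env) := (sval e).2.
pose F (e : env) := approximant via_L1 (orc e).
have gramP e xs : size xs = 5 -> eval (orc e) H xs (gram e xs).
  exact: (svalP e).1.
have queryable2 n (C : ctx env) : queryable orc n (fun c : C => part 2 (orc (ctx_env c))).
  by apply: queryable_part; [exact: computable_cst | exact: queryable_orc].
have queryableF n (C : ctx env) (j : C -> nat) : computable orc j ->
    queryable orc n (fun c => F (ctx_env c) (j c)).
  move=> hj; rewrite /F /approximant; case: (via_L1); last exact: queryable2.
  apply: queryable_part => //; apply: queryable_part; first exact: computable_cst.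
  exact: queryable2.
have searchable e K j : exists t,
    certified (part 0 (orc e)) (part 1 (orc e)) (gram e) (F e j) K t.
  exact: (svalP e).2.
pose C1 := ctx_input env 1.
have hK : computable orc (fun c : C1 => nth 0%N c.2 0) by exact: computable_input.
have hj : computable orc (fun c : C1 => approximant_index via_L1 (orc c.1) (nth 0%N c.2 0)).
  rewrite /approximant_index; case: (via_L1); last exact: computable_cst.
  apply: (queryable_part (computable_cst orc C1 1) (queryable2 3%N C1)
    (ts := [:: fun=> 0%N; fun c => nth 0%N c.2 0])) => //.
  by split; first exact: computable_cst.
have [N hN certN] := computable_certificate gramP queryableF searchable hK hj.
have [PN hPN] := computable_input_eval hN.
have hcomp (C : ctx env) (K : C -> nat) : computable orc K ->
    computable orc (fun c => N (ctx_env c, [:: K c])).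
  move=> hc; apply: (@computable_comp _ _ _ PN (fun e xs => N (e, xs)) [:: K]) => //.
have hfl n i j : (i < n)%N -> (j < n)%N ->
    computable orc (fun c : ctx_input env n => inv_floor (nth 0%N c.2 i) (nth 0%N c.2 j)).
  move=> hi hj'; apply: computable_divS; last exact: computable_input.
  by apply: computable_succ; exact: computable_input.
have hn : computable orc (fun c : ctx_input env 2 =>
    norm_rate_oracle (fun K => N (c.1, [:: K])) c.2).
  have hk := hfl 2%N 0%N 1%N isT isT.
  apply: computable_mul; last exact: computable_succ.
  apply: computable_mul; first exact: computable_cst.
  apply/computable_succ/hcomp/computable_pred/computable_mul; first exact: computable_cst.
  exact: computable_succ.
have hp : computable orc (fun c : ctx_input env 4 =>
    pointwise_rate_oracle (fun K => N (c.1, [:: K])) c.2).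
  have hk1 := computable_succ (hfl 4%N 0%N 1%N isT isT).
  have hk2 := computable_succ (hfl 4%N 2%N 3%N isT isT).
  apply: computable_mul => //; apply: computable_mul; first exact: computable_cst.
  apply: computable_mul; apply: computable_expn; try exact: computable_cst; last by [].
  apply/computable_succ/hcomp/computable_pred/computable_mul => //.
  by apply: computable_mul => //; exact: computable_cst.
have [Pn hPn] := computable_input_eval hn; have [Pp hPp] := computable_input_eval hp.
exists Pn, Pp => o gr h1 h2.
pose e : env := exist _ (o, gr) (conj h1 h2).
exists (fun K => N (e, [:: K])); split.
- by move=> K; exact: (certN (e, [:: K])).
- by move=> xs; exact: (hPn e xs).
- by move=> xs; exact: (hPp e xs).
Qed.

(** * From certified decompositions to represented rates *)

Section Conclusion.
Context d (X : measurableType d) (R : realType) (mu : probability X R).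
Variables (tau : X -> X) (f : X -> R) (t : nat -> nat).
Hypothesis mp : measure_preserving mu tau.

Lemma posq_inv_floor (e : rat) : 0 < e -> (Num.trunc e^-1).+1%:R^-1 <= ratr e :> R.
Proof.
move=> e0; rewrite -ratr_inv_nat ler_rat invf_ple ?posrE//.
by rewrite ltW// truncnS_gt.
Qed.

(** The factor 2 serves the L1 case, where the residual has two parts of size [1 / (K + 1)]: one
    from the certificate, one from exchanging [f] for an L2 function. The condition on [h] covers
    both [p = 1] and [p = 2]. *)
Lemma rep_rate_avg p : 1 <= p ->
  (forall h, h \in Lfun mu 2%:E -> h \in Lfun mu p%:E /\ rnorm mu p h <= rnorm mu 2 h) ->
  f \in Lfun mu p%:E ->
  (forall K, exists (c : R) h, [/\ h \in Lfun mu 2%:E, rnorm mu 2 h <= (t K)%:R &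
    rnorm mu p (f \- cst c \- (h \- koopman tau h)) <= 2 / K.+1%:R]) ->
  rep_rate (Ldist mu p%:E (avg tau f)) (norm_rate_oracle t).
Proof.
move=> p1 p2 hf ht; exists (fun e => norm_rate_value t (Num.trunc e^-1)); last first.
  by move=> p' q'; rewrite inv_floorE.
move=> e e0; set k := Num.trunc e^-1; split; first by rewrite !muln_gt0.
move=> m hm; have [c [h [hh h2 hr]]] := ht (8 * k.+1).-1.
have [hp hp2] := p2 h hh.
rewrite /Ldist rnormE; last by apply: LfunB => //; exact: Lfun_avg.
rewrite lte_fin; apply: lt_le_trans (posq_inv_floor e0).
apply: (norm_rate mp p1 hf hp _ (le_trans hp2 h2) hm).
apply: le_trans hr _; rewrite prednK ?muln_gt0//.
rewrite (_ : (8 * k.+1 = 2 * (4 * k.+1))%N); last by rewrite mulnA.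
by rewrite natrM invfM mulVKf.
Qed.

Lemma rep_pointwise_avg : f \in Lfun mu 1 ->
  (forall K, exists (c : R) h, [/\ h \in Lfun mu 2%:E, rnorm mu 2 h <= (t K)%:R &
    rnorm mu 1 (f \- cst c \- (h \- koopman tau h)) <= 2 / K.+1%:R]) ->
  rep_pointwise mu (avg tau f) (pointwise_rate_oracle t).
Proof.
move=> hf ht.
exists (fun e1 e2 => pointwise_rate_value t (Num.trunc e1^-1) (Num.trunc e2^-1)); last first.
  by move=> p1 q1 p2 q2; rewrite !inv_floorE.
move=> l1 l2 l10 l20; set k1 := Num.trunc l1^-1; set k2 := Num.trunc l2^-1.
split; first by rewrite !muln_gt0.
move=> k hk; have [c [h [hh h2 hr]]] := ht (16 * k1.+1 * k2.+1).-1.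
apply: (@le_trans _ _ (k2.+1%:R^-1)%:E); last by rewrite lee_fin posq_inv_floor.
apply: (pointwise_rate mp hf hh _ h2 (posq_inv_floor l10) hk).
apply: le_trans hr _; rewrite prednK ?muln_gt0//.
rewrite (_ : (16 * k1.+1 * k2.+1 = 2 * (8 * k1.+1 * k2.+1))%N); last by rewrite !mulnA.
by rewrite natrM invfM mulVKf.
Qed.

End Conclusion.

Theorem corollary5p4 (R : realType) (G : prog) :
  (exists P2 P1 Pp : prog,
    forall (d : measure_display) (X : measurableType d) (mu : probability X R)
      (tau : X -> X) (b : nat -> X -> R),
      L2_basis mu b -> inner_product_computed_by mu b G ->
      measure_preserving mu tau -> ergodic mu tau ->
      forall f : X -> R, f \in Lfun mu 2%:E ->
      forall w : baire, rep_data mu tau b (rep_L2 mu b f) w ->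
      [/\ computes P2 w (rep_rate (Ldist mu 2%:E (avg tau f))),
          computes P1 w (rep_rate (Ldist mu 1%:E (avg tau f))) &
          computes Pp w (rep_pointwise mu (avg tau f))]) /\
  (exists P1 Pp : prog,
    forall (d : measure_display) (X : measurableType d) (mu : probability X R)
      (tau : X -> X) (b : nat -> X -> R),
      L2_basis mu b -> inner_product_computed_by mu b G ->
      measure_preserving mu tau -> ergodic mu tau ->
      forall f : X -> R, f \in Lfun mu 1%:E ->
      forall w : baire, rep_data mu tau b (rep_L1_approx mu b f) w ->
      computes P1 w (rep_rate (Ldist mu 1%:E (avg tau f))) /\
      computes Pp w (rep_pointwise mu (avg tau f))).
Proof.
have p2 : 1 <= 2 :> R by rewrite ler1n.
have le12 n : n%:R^-1 <= 2 / n%:R :> R by rewrite ler_peMl ?invr_ge0.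
split.
- have [Pn [Pp hP]] := search_programs false (query_part0 5 G).
  (* The same program bounds both norm rates: its value depends only on the certified [t], and L1
     norms are at most L2 norms. *)
  exists Pn, Pn, Pp => d X mu tau b hb hG mp erg f hf w [hwm hwk hF].
  have [gr hgr evG] := hG _ hwm.
  have [|K j|t [ct hn hp]] := hP w gr.
  + by move=> xs sxs; apply: eval_query_part0.
  + exact: (certified_complete mp hb hf hwm hgr hwk hF).
  have dec K := certified_sound mp hb hf hwm hgr hwk hF (ct K).
  have dec2 K : exists (c : R) h, [/\ h \in Lfun mu 2%:E, rnorm mu 2 h <= (t K)%:R &
      rnorm mu 2 (f \- cst c \- (h \- koopman tau h)) <= 2 / K.+1%:R].
    have [c [h [hh h1 h2]]] := dec K; exists c, h; split => //; exact: le_trans h2 _.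
  have dec1 K : exists (c : R) h, [/\ h \in Lfun mu 2%:E, rnorm mu 2 h <= (t K)%:R &
      rnorm mu 1 (f \- cst c \- (h \- koopman tau h)) <= 2 / K.+1%:R].
    have [c [h [hh h1 h2]]] := dec2 K; exists c, h; split => //; apply: le_trans h2.
    apply: rnorm12; apply: LfunB => //; first by apply: LfunB => //; exact: Lfun_cst.
    by apply: LfunB => //; exact: Lfun_koopman.
  have hf1 := Lfun21 hf.
  split.
  + by exists (norm_rate_oracle t) => //; exact: rep_rate_avg.
  + exists (norm_rate_oracle t) => //; apply: rep_rate_avg => // h hh.
    by split; [exact: Lfun21 | exact: rnorm12].
  + by exists (pointwise_rate_oracle t) => //; exact: rep_pointwise_avg.
have [Pn [Pp hP]] := search_programs true (query_part0 5 G).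
exists Pn, Pp => d X mu tau b hb hG mp erg f hf w [hwm hwk [g [hg cv hF [r hr rE]]]].
have [gr hgr evG] := hG _ hwm.
have [|K j|t [ct hn hp]] := hP w gr.
- by move=> xs sxs; apply: eval_query_part0.
- exact: (certified_complete mp hb (hg j) hwm hgr hwk (hF j)).
have q1 : 1 <= 1 :> R by [].
have hg1 j : g j \in Lfun mu 1 by exact: Lfun21.
have dec K : exists (c : R) h, [/\ h \in Lfun mu 2%:E, rnorm mu 2 h <= (t K)%:R &
    rnorm mu 1 (f \- cst c \- (h \- koopman tau h)) <= 2 / K.+1%:R].
  (* The certificate concerns the approximant [g j] whose L1 distance to [f] is at most
     [1 / (K + 1)]; its index is read from the given rate. *)
  have := ct K; set j := approximant_index true w K => cj.
  have [c [h [hh h1 h2]]] := certified_sound mp hb (hg j) hwm hgr hwk (hF j) cj.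
  exists c, h; split => //.
  have hres : g j \- cst c \- (h \- koopman tau h) \in Lfun mu 2%:E.
    apply: LfunB => //; first by apply: LfunB => //; exact: Lfun_cst.
    by apply: LfunB => //; exact: Lfun_koopman.
  rewrite (_ : f \- cst c \- _ = (f \- g j) \+ (g j \- cst c \- (h \- koopman tau h))); last first.
    by apply/funext => x /=; ring.
  apply: le_trans (rnormD q1 (LfunB q1 hf (hg1 j)) (Lfun21 hres)) _.
  rewrite mulrDl mul1r; apply: lerD; last exact: le_trans (rnorm12 hres) h2.
  have := rate_limit q1 hg1 hf cv hr (posq_gt0 0 K).
  by rewrite posq0 ratr_inv_nat -posq0 -rE.
split.
- exists (norm_rate_oracle t) => //; apply: rep_rate_avg => // h hh.
  by split; [exact: Lfun21 | exact: rnorm12].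
- by exists (pointwise_rate_oracle t) => //; exact: rep_pointwise_avg.
Qed.
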